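(* Let $\mathbb F$ be a field. Let $P(s)\in\mathbb F[s]^{m\times n}$, $\deg(P(s))=d$, $\mathrm{rank}(P(s))=r$. Let $\mathbf c=(c_1,\dots,c_{n-r})$ be the column minimal indices of $P(s)$. Let $z$ and $x$ be integers such that $0\le x\le\min\{z,n-r\}$ and let $d_1\ge\dots\ge d_{n-r-x}\ge0$ be non negative integers. There exists a polynomial matrix $W(s)\in\mathbb F[s]^{z\times n}$ such that $\deg(W(s))\le d$, $\mathrm{rank}\begin{bmatrix}P(s)\\ W(s)\end{bmatrix}=r+x$ and $\begin{bmatrix}P(s)\\ W(s)\end{bmatrix}$ has $\mathbf d=(d_1,\dots,d_{n-r-x})$ as column minimal indices if and only if both of the following hold: (i) $\sum_{i=1}^{n-r-x}d_i-\sum_{i=1}^{n-r}c_i\le xd$; (ii) $\mathbf c\prec'(\mathbf d,\hat{\mathbf a})$; where $\hat{\mathbf a}=(\hat a_1,\dots,\hat a_x)$ is $$\hat a_1=\sum_{i=1}^{n-r}c_i-\sum_{i=1}^{n-r-x}d_i+(x-1)d,\qquad \hat a_j=-d,\quad 2\le j\le x.$$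
   Context: Polynomial matrices. For a polynomial matrix $P(s)=P_ds^d+\dots+P_1s+P_0\in\mathbb F[s]^{m\times n}$ with $P_i\in\mathbb F^{m\times n}$ and $P_d\ne0$, $\deg(P(s))=d$. $\mathrm{rank}(P(s))$ is the (normal) rank of $P(s)$ as a matrix over the field of fractions $\mathbb F(s)$. If $\mathrm{rank}(P(s))=r$, the column minimal indices $c_1\ge\dots\ge c_{n-r}\ge 0$ are the degrees (in nonincreasing order) of the vectors of a minimal polynomial basis of the right null space of $P(s)$ over $\mathbb F(s)$. Conventions. Sums $\sum_{i=p}^{q}$ with $p>q$ are $0$, and conditions stated for $p\le i\le q$ with $p>q$ are trivially satisfied. In formulas, $d$ without subscript is the degree of $P(s)$, while $d_i$ are the entries of $\mathbf d$. Sequences. Writing $\mathbf a=(a_1,\dots,a_m)$ for a finite (possibly empty) sequence of integers presupposes $a_1\ge\dots\ge a_m$, and one sets $a_i=+\infty$ for $i<1$ and $a_i=-\infty$ for $i>m$. (For $\hat{\mathbf a}$ in the claim the ordering is automatic when (i) holds, so (ii) makes sense.) Generalized majorization. For sequences of integers $\mathbf d=(d_1,\dots,d_p)$, $\mathbf a=(a_1,\dots,a_q)$, $\mathbf g=(g_1,\dots,g_{p+q})$, $\mathbf g\prec'(\mathbf d,\mathbf a)$ means: (1) $d_i\ge g_{i+q}$ for $1\le i\le p$; (2) $\sum_{i=1}^{h_j}g_i-\sum_{i=1}^{h_j-j}d_i\le\sum_{i=1}^{j}a_i$ for $1\le j\le q$, where $h_j=\min\{i: d_{i-j+1}<g_i\}$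 (with $d_{p+1}=-\infty$); (3) $\sum_{i=1}^{p+q}g_i=\sum_{i=1}^{p}d_i+\sum_{i=1}^{q}a_i$. (If $q=0$ this means $\mathbf g=\mathbf d$.) *)

(* Defs.v *)
From mathcomp Require Import all_boot all_order all_algebra.
From mathcomp Require Import constructive_ereal.

Set Implicit Arguments.
Unset Strict Implicit.
Unset Printing Implicit Defensive.

Import Order.TTheory GRing.Theory Num.Theory.

Local Open Scope ring_scope.

Section PolynomialMatrices.
Variable F : fieldType.

(* max over the entries; the zero matrix gets degree 0 *)
Definition mxdeg m n (P : 'M[{poly F}]_(m, n)) : nat :=
  (\max_(i < m) \max_(j < n) (size (P i j)).-1)%N.

Definition to_ratfun m n (P : 'M[{poly F}]_(m, n)) :
  'M[{fraction {poly F}}]_(m, n) := map_mx (@FracField.tofrac _) P.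

Definition normal_rank m n (P : 'M[{poly F}]_(m, n)) : nat :=
  \rank (to_ratfun P).

(* The columns of N are a basis, over F(s), of the right null space of P.
   Row spaces are those of mxalgebra, whence the transpositions. *)
Definition null_basis m n k (P : 'M[{poly F}]_(m, n))
    (N : 'M[{poly F}]_(n, k)) : bool :=
  row_free (to_ratfun N)^T && ((to_ratfun N)^T == kermx (to_ratfun P)^T)%MS.

Definition col_degree n k (N : 'M[{poly F}]_(n, k)) (j : 'I_k) : nat :=
  mxdeg (col j N).

(* Minimal in Forney's sense: least sum of the column degrees. *)
Definition minimal_null_basis m n k (P : 'M[{poly F}]_(m, n))
    (N : 'M[{poly F}]_(n, k)) : Prop :=
  null_basis P N /\
  forall N' : 'M[{poly F}]_(n, k), null_basis P N' ->
    (\sum_(j < k) col_degree N j <= \sum_(j < k) col_degree N' j)%N.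

Definition column_minimal_indices m n (P : 'M[{poly F}]_(m, n))
    (c : seq nat) : Prop :=
  exists k (N : 'M[{poly F}]_(n, k)),
    minimal_null_basis P N /\ c = sort geq (codom (col_degree N)).

End PolynomialMatrices.

(* 1-based: ext a i is a_i, with a_0 = +oo and a_i = -oo beyond the length.
   Indices being in nat, a truncated subtraction i.+1 - j stands for i - j + 1:
   it is 0 exactly when i - j + 1 < 1. *)
Definition ext (a : seq int) (i : nat) : \bar int :=
  if i == 0%N then +oo%E
  else if (i <= size a)%N then (nth 0 a i.-1)%:E else -oo%E.

(* h_j = min {i : d_(i-j+1) < g_i}; see maj_hP *)
Definition maj_h (d g : seq int) (j : nat) : nat :=
  find (fun i => (ext d (i.+1 - j) < ext g i)%E) (iota 0 (size g).+1).

Lemma maj_hP (d g : seq int) (q j : nat) :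
  size g = (size d + q)%N -> (1 <= j <= q)%N ->
  (ext d ((maj_h d g j).+1 - j) < ext g (maj_h d g j))%E /\
  (forall i, (ext d (i.+1 - j) < ext g i)%E -> (maj_h d g j <= i)%N).
Proof.
move=> sg /andP[j1 jq]; rewrite /maj_h; set P := (X in find X).
have Ph : P (size d + j)%N.
  rewrite /P /ext subSn ?leq_addl // addnK ltnn addn_eq0.
  by rewrite [j == _]eqn0Ngt j1 andbF sg leq_add2l jq /= ltNyr.
have szP : (size d + j < (size g).+1)%N by rewrite ltnS sg leq_add2l.
have hasP : has P (iota 0 (size g).+1).
  by apply/hasP; exists (size d + j)%N => //; rewrite mem_iota.
have fl : (find P (iota 0 (size g).+1) < (size g).+1)%N.
  by rewrite -[X in (_ < X)%N](size_iota 0) -has_find.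
split; first by have := nth_find 0%N hasP; rewrite nth_iota.
move=> i Pi; rewrite leqNgt; apply/negP => lti.
have := before_find 0%N lti.
by rewrite nth_iota ?(ltn_trans lti) // add0n /P Pi.
Qed.

(* g <' (d, a); d, a, g are meant to be nonincreasing. *)
Definition gen_maj (g d a : seq int) : Prop :=
  [/\ size g = (size d + size a)%N,
      forall i, (1 <= i <= size d)%N -> (ext g (i + size a) <= ext d i)%E,
      forall j, (1 <= j <= size a)%N ->
        \sum_(v <- take (maj_h d g j) g) v
          - \sum_(v <- take (maj_h d g j - j) d) v
        <= \sum_(v <- take j a) v
    & \sum_(v <- g) v = \sum_(v <- d) v + \sum_(v <- a) v].

Lemma gen_maj_nil (g d : seq int) : gen_maj g d [::] <-> g = d.
Proof.
split=> [[/= sg le_gd _]|->]; last first.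
  split=> //=; rewrite ?addn0 ?big_nil ?addr0 // => i.
  - by rewrite addn0.
  - by case: i.
rewrite addn0 in sg; rewrite big_nil addr0 => eq_sum.
have Es (s : seq int) : \sum_(v <- s) v = \sum_(k < size s) s`_k.
  by rewrite (big_nth 0) big_mkord.
have le i : (i < size d)%N -> g`_i <= d`_i.
  by move=> ltid; have := le_gd i.+1 ltid; rewrite addn0 /ext sg /= ltid lee_fin.
apply: (@eq_from_nth _ 0) => // i; rewrite sg => ltid; apply/eqP.
have : \sum_(k < size d) (d`_k - g`_k) == 0.
  by rewrite sumrB subr_eq0 -{1}Es -eq_sum Es sg.
rewrite psumr_eq0 => [/allP/(_ (Ordinal ltid))|k _]; last by rewrite subr_ge0 le.
by rewrite mem_index_enum subr_eq0 eq_sym => /(_ isT).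
Qed.

Definition a_hat (c ds : seq nat) (d x : nat) : seq int :=
  if x is x'.+1 then
    ((sumn c)%:Z - (sumn ds)%:Z + (x' * d)%:Z) :: nseq x' (- d%:Z)
  else [::].

(* Main.v *)
Require Import Defs.
From mathcomp Require Import all_boot all_order all_algebra.
From HB Require Import structures.
From mathcomp Require Import fingroup perm constructive_ereal zify.
From Stdlib Require Import Classical_Prop.

Set Implicit Arguments.
Unset Strict Implicit.
Unset Printing Implicit Defensive.

Import Order.TTheory GRing.Theory Num.Theory.
Local Open Scope ring_scope.

(** Let V be the right null space of P over F(s), with minimal basis N and
    indices c, and put W N = B.  The null space of the completed matrix is
    { N u | B u = 0 }.  The argument compares dimensions over F of spaces of
    polynomial vectors of bounded degree.

    A minimal basis has predictable degrees ([minimal_generates]): a polynomial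
    vector of V of degree less than T is N u with u polynomial and u_j of degree
    less than T - c_j.  Hence all such vectors form a space of dimension
    sum_j max (0, T - c_j), and [dimension_count] compares such dimensions along
    a polynomial matrix.

    Conditions (i) and (ii) are equivalent to inequalities indexed by a
    threshold T ([gen_maj_of_dominates], [dominates_of_gen_maj]): with all sums
    over the entries smaller than T,
    #{ d_i } <= #{ c_i }  and  sum (d_i + d) <= sum (c_i + d).

    Necessity ([necessity]).  Let I and J be the sets of indices with c_i < T and
    d_j < T.  The restriction of B to the columns in I has rank
    y <= #I - #J, since it kills the new basis vectors with index in J, and these
    generate everything of degree less than T that it kills.  Since y of its
    rows define its kernel and W has degree at most d, counting dimensions gives
    sum_I (T - c_i) <= y (T + d) + sum_J (T - d_j), which rearranges to the
    second inequality.

    Sufficiency ([sufficiency]).  Rows are added one at a time.  A row w of degree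
    at most d acts on V through b = w N, where b_j has degree at most d + c_j, and
    every such b occurs ([functional_realized]): the minimal indices of the row
    space of P are at most d and their sum is at least that of c, so the
    dimensions leave no room for a cokernel.  If b is a suitable chain of
    powers of the indeterminate, the indices of its kernel arise from c by
    deleting one entry v and raising entries that are at least v by a total of
    at most d + v ([one_row_step]).  It remains to go from c to the prescribed indices
    by x such steps.  Matching greedily from the largest entries decides which entries
    are deleted and where the others must end ([assign_fates]); each deletion,
    beginning with the smallest, spends its credit d + v on the smallest
    entries that are not yet final ([spread]), and the threshold inequalities say
    that the credit never runs out ([affordable_assign_fates]). *)

(** * Dimension count for polynomial vectors of bounded degree *)

Section Count.
Variable F : fieldType.

(** Bounds are on sizes, that is, on degree plus one: the bound 0 forces an
    entry to vanish, so that a truncated difference T - c_i carries both the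
    degree bound and the condition that u_i = 0 when c_i >= T. *)
Definition bounded n (a : 'I_n -> nat) (v : 'cV[{poly F}]_n) :=
  forall i, (size (v i 0%R) <= a i)%N.

Definition coord_index n (a : 'I_n -> nat) : finType :=
  {i : 'I_n & 'I_(a i)}.

Definition coords n (a : 'I_n -> nat) (v : 'cV[{poly F}]_n) :
  'rV[F]_#|coord_index a| :=
  \row_x (let it : {i : 'I_n & 'I_(a i)} := enum_val x in
          (v (tag it) 0)`_(tagged it)).

Definition uncoords n (a : 'I_n -> nat)
    (r : 'rV[F]_#|coord_index a|) : 'cV[{poly F}]_n :=
  \col_i \sum_(t < a i) r 0 (enum_rank (Tagged (fun i => 'I_(a i)) t : coord_index a)) *: 'X^t.

Lemma card_coords n (a : 'I_n -> nat) :
  #|coord_index a| = (\sum_i a i)%N.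
Proof.
rewrite card_tagged sumnE big_map big_enum /=.
by apply: eq_bigr => i _; rewrite card_ord.
Qed.

Lemma bounded_uncoords n (a : 'I_n -> nat) r : bounded a (@uncoords n a r).
Proof.
move=> i; rewrite mxE; apply: (leq_trans (size_sum _ _ _)).
apply/bigmax_leqP => t _; apply: (leq_trans (size_scale_leq _ _)).
by rewrite size_polyXn.
Qed.

Lemma coordsK n (a : 'I_n -> nat) v : bounded a v -> uncoords (coords a v) = v.
Proof.
move=> bv; apply/colP => i; rewrite mxE; apply/polyP => l.
rewrite coef_sum; under eq_bigr => t _ do rewrite coefZ mxE enum_rankK /= coefXn.
have [ltl|lel] := ltnP l (a i).
  rewrite (bigD1 (Ordinal ltl)) //= eqxx mulr1 big1 ?addr0 // => t neq.
  by case: eqP => // E; [case/eqP: neq; apply/val_inj | rewrite mulr0].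
rewrite big1 => [|t _]; last first.
  by rewrite gtn_eqF ?mulr0 // (leq_trans (ltn_ord t)).
by rewrite nth_default // (leq_trans (bv i)).
Qed.

Lemma coords_linear n (a : 'I_n -> nat) c u v :
  coords a (c%:P *: u + v) = c *: coords a u + coords a v.
Proof. by apply/rowP => x; rewrite !mxE /= !mxE coefD coefCM. Qed.

Lemma uncoords_linear n (a : 'I_n -> nat) c r s :
  @uncoords n a (c *: r + s) = c%:P *: uncoords r + uncoords s.
Proof.
apply/colP => i; rewrite !mxE mulr_sumr -big_split /=; apply: eq_bigr => t _.
by rewrite !mxE scalerDl -mul_polyC polyCM -mulrA !mul_polyC.
Qed.

Lemma uncoordsK n (a : 'I_n -> nat) r : coords a (@uncoords n a r) = r.
Proof.
apply/rowP => x; rewrite !mxE /= !mxE coef_sum.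
case E: (enum_val x) => [i t] /=.
rewrite (bigD1 t) //= coefZ coefXn eqxx mulr1 big1 ?addr0 => [|u neq].
  by congr (r 0 _); rewrite -[RHS]enum_valK E.
by rewrite coefZ coefXn; case: eqP => [e|]; [case/eqP: neq; apply/val_inj|rewrite mulr0].
Qed.

Section CoordMx.
Variables (m n : nat) (a : 'I_n -> nat) (b : 'I_m -> nat).
Variable A : 'M[{poly F}]_(m, n).
Let f r := coords b (A *m @uncoords n a r).
Lemma coord_mul_linear : linear f.
Proof.
move=> c r s.
by rewrite /f uncoords_linear mulmxDr -scalemxAr coords_linear.
Qed.
HB.instance Definition _ := GRing.isLinear.Build F _ _ _ f coord_mul_linear.
Definition coord_mx := lin1_mx f.
Lemma mul_coord_mx r : r *m coord_mx = coords b (A *m @uncoords n a r).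
Proof. by rewrite /coord_mx mul_rV_lin1. Qed.
End CoordMx.

(** Rank and nullity of A between two spaces of bounded vectors, of dimensions
    sum a and sum b, when the kernel is covered by a space of dimension sum e;
    if the bound on the rank is attained, A is onto. *)
Lemma dimension_count m n k (A : 'M[{poly F}]_(m, n)) (G : 'M[{poly F}]_(n, k))
    (a : 'I_n -> nat) (b : 'I_m -> nat) (e : 'I_k -> nat) :
  (forall v, bounded a v -> bounded b (A *m v)) ->
  (forall v, bounded a v -> A *m v = 0 ->
     exists2 u, bounded e u & v = G *m u) ->
  (\sum_i a i <= \sum_i b i + \sum_i e i)%N /\
  ((\sum_i b i + \sum_i e i <= \sum_i a i)%N ->
   forall y, bounded b y -> exists2 v, bounded a v & A *m v = y).
Proof.
move=> Ab ker.
have kerS : (kermx (coord_mx a b A) <= coord_mx e a G)%MS.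
  apply/rV_subP => r /sub_kermxP; rewrite mul_coord_mx => Ar0.
  have Av0 : A *m uncoords r = 0.
    rewrite -(coordsK (Ab _ (bounded_uncoords r))) Ar0.
    apply/colP => i; rewrite !mxE big1 // => t _; rewrite mxE scale0r //.
  have [u bu ru] := ker _ (bounded_uncoords r) Av0.
  apply/submxP; exists (coords e u).
  by rewrite mul_coord_mx coordsK // -ru uncoordsK.
have le_a : (\sum_i a i <= \sum_i e i + \rank (coord_mx a b A))%N.
  rewrite -(card_coords a) -(card_coords e) addnC -leq_subLR -mxrank_ker.
  exact: leq_trans (mxrankS kerS) (rank_leq_row _).
split.
  apply: (leq_trans le_a); rewrite addnC leq_add2r.
  by rewrite -(card_coords b) rank_leq_col.
move=> le_ba y by_.
have full : row_full (coord_mx a b A).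
  rewrite -col_leq_rank {1}card_coords.
  by rewrite -(leq_add2r (\sum_i e i)) (leq_trans le_ba) // addnC.
have /submxP[r Er] := submx_full (coords b y) full.
exists (uncoords r); first exact: bounded_uncoords.
rewrite mul_coord_mx in Er.
by rewrite -(coordsK (Ab _ (bounded_uncoords r))) -Er coordsK.
Qed.

End Count.

(** * Null bases in polynomial terms *)

Section NullBasis.
Variable F : fieldType.
Local Open Scope quotient_scope.
Implicit Types m n k : nat.
Local Notation tofrac := (@FracField.tofrac {poly F}).

Definition col_free n k (N : 'M[{poly F}]_(n, k)) :=
  forall u : 'cV_k, N *m u = 0 -> u = 0.

Lemma to_ratfunM m n k (A : 'M[{poly F}]_(m, n)) (B : 'M_(n, k)) :
  to_ratfun (A *m B) = to_ratfun A *m to_ratfun B.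
Proof. exact: map_mxM. Qed.

Lemma to_ratfunT m n (A : 'M[{poly F}]_(m, n)) :
  to_ratfun A^T = (to_ratfun A)^T.
Proof. by rewrite /to_ratfun map_trmx. Qed.

Lemma to_ratfun_eq0 m n (A : 'M[{poly F}]_(m, n)) :
  (to_ratfun A == 0) = (A == 0).
Proof.
apply/eqP/eqP => [/matrixP eA|->]; last exact: map_mx0.
apply/matrixP => i j; apply/eqP; rewrite mxE -tofrac_eq0.
by have := eA i j; rewrite !mxE => ->.
Qed.

Lemma to_ratfun_inj m n : injective (@to_ratfun F m n).
Proof.
move=> A B eAB; apply/eqP; rewrite -subr_eq0 -to_ratfun_eq0 /to_ratfun.
by rewrite map_mxB subr_eq0; apply/eqP.
Qed.

Lemma to_ratfunZ m n q (A : 'M[{poly F}]_(m, n)) :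
  to_ratfun (q *: A) = tofrac q *: to_ratfun A.
Proof. by apply/matrixP => i j; rewrite !mxE rmorphM. Qed.

Lemma clear_denom1 (x : {fraction {poly F}}) :
  exists2 q : {poly F}, q != 0 & exists p, tofrac q * x = tofrac p.
Proof.
elim/quotW: x => x; exists (frac x).2; first exact: denom_ratioP.
exists (frac x).1; unlock FracField.tofrac; rewrite -[LHS]FracField.pi_mul; apply/eqmodP.
rewrite /= FracField.equivfE /FracField.mulf !numden_Ratio ?oner_neq0 //.
  by rewrite mul1r mulr1.
all: by rewrite mul1r denom_ratioP.
Qed.

Lemma clear_denominators m n (A : 'M[{fraction {poly F}}]_(m, n)) :
  exists2 q : {poly F}, q != 0 &
    exists U : 'M[{poly F}]_(m, n), tofrac q *: A = to_ratfun U.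
Proof.
have /fin_all_exists2[q q0 /fin_all_exists[p Ep]] :
  forall ij : 'I_m * 'I_n, exists2 q : {poly F}, q != 0 &
  exists p, tofrac q * A ij.1 ij.2 = tofrac p by move=> ij; exact: clear_denom1.
exists (\prod_ij q ij); first by apply/prodf_neq0 => ij _.
exists (\matrix_(i, j) ((\prod_(ij | ij != (i, j)) q ij) * p (i, j))).
apply/matrixP => i j; rewrite !mxE (bigD1 (i, j)) //= [q _ * _]mulrC.
by rewrite !rmorphM /= -mulrA (Ep (i, j)).
Qed.

Lemma col_freeP n k (N : 'M[{poly F}]_(n, k)) :
  row_free (to_ratfun N)^T <-> col_free N.
Proof.
split=> [fN u Nu0 | fN].
  apply/trmx_inj/to_ratfun_inj/(row_free_inj fN) => /=.
  rewrite -to_ratfunT -!to_ratfunM -trmx_mul Nu0 !trmx0.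
  by rewrite mul0mx.
apply: inj_row_free => v vN0.
have [q q0 [U EU]] := clear_denominators v.
have : U^T = 0.
  apply: fN; apply/trmx_inj/to_ratfun_inj.
  rewrite trmx_mul trmxK to_ratfunM to_ratfunT -EU -scalemxAl vN0 scaler0 trmx0.
  by rewrite /to_ratfun map_mx0.
move/(canRL (@trmxK _ _ _)); rewrite trmx0 => U0.
have /eqP : tofrac q *: v = 0 by rewrite EU U0 /to_ratfun map_mx0.
by rewrite scaler_eq0 tofrac_eq0 (negPf q0) => /eqP.
Qed.

Lemma mul_to_ratfun_eq0 m n k (P : 'M[{poly F}]_(m, n)) (N : 'M_(n, k)) :
  ((to_ratfun N)^T *m (to_ratfun P)^T == 0) = (P *m N == 0).
Proof. by rewrite -!to_ratfunT -to_ratfunM to_ratfun_eq0 -trmx_mul trmx_eq0. Qed.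

(** A polynomial relation among the columns can be tested with polynomial
    coefficients, by clearing denominators; a free family of null vectors is
    then a basis as soon as its length is the nullity. *)
Lemma null_basisE m n k (P : 'M[{poly F}]_(m, n)) (N : 'M_(n, k)) :
  null_basis P N <->
  [/\ P *m N = 0, col_free N & (k + normal_rank P = n)%N].
Proof.
have rkK : \rank (kermx (to_ratfun P)^T) = (n - normal_rank P)%N.
  by rewrite mxrank_ker mxrank_tr.
have leP : (normal_rank P <= n)%N by exact: rank_leq_col.
rewrite /null_basis; split=> [/andP[fN eqN]|[PN fN rkP]].
  split; last 1 first.
  - have := eqmx_rank eqN.
    by rewrite rkK; move: fN; rewrite /row_free => /eqP->; lia.
  - by apply/eqP; rewrite -mul_to_ratfun_eq0; apply/eqP/sub_kermxP; case/andP: eqN.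
  exact/col_freeP.
have fN' : row_free (to_ratfun N)^T by apply/col_freeP.
rewrite fN' /=.
have sN : ((to_ratfun N)^T <= kermx (to_ratfun P)^T)%MS.
  by apply/sub_kermxP/eqP; rewrite mul_to_ratfun_eq0 PN.
rewrite -(mxrank_leqif_eq sN) rkK; move: fN'; rewrite /row_free => /eqP ->.
by apply/eqP; lia.
Qed.

Lemma null_basis_coord m n k (P : 'M[{poly F}]_(m, n)) (N : 'M_(n, k)) v :
  null_basis P N -> P *m v = 0 ->
  exists2 q, q != 0 & exists u : 'cV_k, q *: v = N *m u.
Proof.
move=> /andP[_ /andP[_ sK]] Pv0.
have : ((to_ratfun v)^T <= (to_ratfun N)^T)%MS.
  apply: submx_trans sK; apply/sub_kermxP/eqP.
  by rewrite mul_to_ratfun_eq0 Pv0.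
case/submxP => D ED; have [q q0 [U EU]] := clear_denominators D.
exists q => //; exists U^T; apply/trmx_inj/to_ratfun_inj.
rewrite trmx_mul trmxK to_ratfunM -EU -scalemxAl !to_ratfunT -ED.
by rewrite to_ratfunZ linearZ.
Qed.

Lemma null_basis_intro m n k (P : 'M[{poly F}]_(m, n)) (N : 'M_(n, k)) :
  P *m N = 0 -> col_free N ->
  (forall v : 'cV_n, P *m v = 0 ->
     exists2 q, q != 0 & exists u : 'cV_k, q *: v = N *m u) ->
  null_basis P N.
Proof.
move=> PN fN gen; apply/andP; split; first exact/col_freeP.
apply/andP; split.
  by apply/sub_kermxP/eqP; rewrite mul_to_ratfun_eq0 PN.
apply/row_subP => i.
have [q q0 [U EU]] := clear_denominators (row i (kermx (to_ratfun P)^T)).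
have PU : P *m U^T = 0.
  apply/eqP; rewrite -mul_to_ratfun_eq0 to_ratfunT trmxK -EU -scalemxAl.
  by rewrite -row_mul mulmx_ker row0 scaler0.
have [q' q'0 [u Eu]] := gen _ PU.
have q''0 : tofrac (q' * q) != 0 by rewrite tofrac_eq0 mulf_neq0.
rewrite -(eqmx_scale _ q''0) rmorphM -scalerA EU -to_ratfunZ.
have -> : q' *: U = (N *m u)^T.
  by rewrite -Eu; apply/matrixP => a b; rewrite !mxE.
by rewrite trmx_mul to_ratfunM (to_ratfunT N) submxMl.
Qed.

Lemma exists_null_basis m n (P : 'M[{poly F}]_(m, n)) :
  exists k (N : 'M_(n, k)), null_basis P N.
Proof.
pose B := row_base (kermx (to_ratfun P)^T).
have [q q0 [U EU]] := clear_denominators B.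
have q0' : tofrac q != 0 by rewrite tofrac_eq0.
exists (\rank (kermx (to_ratfun P)^T)), U^T; rewrite /null_basis.
rewrite to_ratfunT trmxK -EU /row_free !(eqmx_scale _ q0').
rewrite [_ == _]row_base_free /=.
exact/eqmxP/eq_row_base.
Qed.

Lemma eq_null_basis m m' n k (P : 'M[{poly F}]_(m, n)) (P' : 'M_(m', n))
    (N : 'M_(n, k)) :
  (forall v : 'cV_n, P *m v = 0 <-> P' *m v = 0) ->
  null_basis P N -> null_basis P' N.
Proof.
move=> PP' nb; have [PN fN _] := (null_basisE _ _).1 nb.
apply: null_basis_intro => // [|v /PP']; last exact: null_basis_coord.
apply/matrixP => i j; rewrite mxE.
have : P' *m (N *m delta_mx j (0 : 'I_1)) = 0 by apply/PP'; rewrite mulmxA PN mul0mx.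
by rewrite mulmxA -colE => /colP/(_ i); rewrite !mxE.
Qed.

End NullBasis.

(** * Minimal bases and predictable degrees *)

Section MinimalBasis.
Variable F : fieldType.
Implicit Types m n k : nat.

Lemma mxdegP m n (A : 'M[{poly F}]_(m, n)) d :
  reflect (forall i j, (size (A i j) <= d.+1)%N) (mxdeg A <= d)%N.
Proof.
rewrite /mxdeg; apply: (iffP (bigmax_leqP _ _ _)) => [le_d i j | le_d i _].
  have /bigmax_leqP/(_ j isT) := le_d i isT.
  by case: (size _).
by apply/bigmax_leqP => j _; case: (size _) (le_d i j).
Qed.

Lemma col_degreeP n k (N : 'M[{poly F}]_(n, k)) j d :
  reflect (forall i, (size (N i j) <= d.+1)%N) (col_degree N j <= d)%N.
Proof.
apply: (iffP (mxdegP _ _)) => [le_d i | le_d i l].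
  by have := le_d i ord0; rewrite mxE.
by rewrite mxE.
Qed.

Lemma size_col_degree n k (N : 'M[{poly F}]_(n, k)) i j :
  (size (N i j) <= (col_degree N j).+1)%N.
Proof. by move: i; apply/col_degreeP. Qed.

(** Exchanging column j with v gives another basis, so minimality of the sum
    of the degrees forbids that v be shorter than column j.  All properties
    of minimal bases used here come from this one. *)
Lemma minimal_exchange m n k (P : 'M[{poly F}]_(m, n)) (N : 'M_(n, k))
    q v u j T :
  minimal_null_basis P N -> q != 0 -> q *: v = N *m u -> u j 0 != 0 ->
  bounded (fun=> T) v -> (col_degree N j < T)%N.
Proof.
move=> [nbN minN] q0 Ev uj bv.
have [PN fN rkP] := (null_basisE _ _).1 nbN.
case: T bv => [|T] bv.
  have v0 : v = 0.
    by apply/colP => i; apply/eqP; rewrite mxE -size_poly_leq0 bv.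
  have u0 : u = 0 by apply: fN; rewrite -Ev v0 scaler0.
  by rewrite u0 mxE eqxx in uj.
pose N' := N + (v - col j N) *m delta_mx 0 j.
have N'E i l : N' i l = if l == j then v i 0 else N i l.
  rewrite !mxE big_ord1 !mxE /=.
  by case: eqP => [->|_]; rewrite ?mulr1 ?mulr0 ?addr0 // addrC subrK.
have N'mul (b : 'cV_k) : N' *m b = N *m b + b j 0 *: (v - col j N).
  rewrite mulmxDl -mulmxA -rowE; congr (_ + _).
  by rewrite [row j b]mx11_scalar mul_mx_scalar mxE.
have nbN' : null_basis P N'.
  apply/null_basisE; split=> //.
    have Pv : P *m v = 0.
      have : q *: (P *m v) = 0 by rewrite scalemxAr Ev mulmxA PN mul0mx.
      move=> Pv; apply/colP => i; have /colP/(_ i)/eqP := Pv.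
      by rewrite !mxE mulf_eq0 (negPf q0) => /eqP.
    rewrite mulmxDr PN add0r mulmxA mulmxBr Pv colE mulmxA PN !mul0mx.
    by rewrite subr0 mul0mx.
  move=> b; rewrite N'mul => Nb0.
  have := fN (q *: b + b j 0 *: (u - q *: delta_mx j 0)).
  rewrite mulmxDr -!scalemxAr mulmxBr -scalemxAr -Ev -colE -scalerBr.
  rewrite scalerA mulrC -scalerA -scalerDr Nb0 scaler0 => /(_ erefl) /colP b0.
  have bj : b j 0 = 0.
    have /eqP := b0 j; rewrite !mxE !eqxx mulr1.
    rewrite mulrBr addrCA [q * _]mulrC subrr addr0 mulf_eq0 (negPf uj) orbF.
    by move/eqP.
  apply/colP => i; have /eqP := b0 i.
  by rewrite bj !mxE mul0r addr0 mulf_eq0 (negPf q0) => /eqP.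
have := minN _ nbN'; rewrite (bigD1 j) //= [X in (_ <= X)%N](bigD1 j) //=.
have -> : (\sum_(i < k | i != j) col_degree N' i =
           \sum_(i < k | i != j) col_degree N i)%N.
  apply: eq_bigr => l lj; congr mxdeg; apply/colP => i.
  by rewrite mxE [RHS]mxE N'E (negPf lj).
rewrite leq_add2r ltnS => /leq_trans; apply.
by apply/col_degreeP => i; rewrite N'E eqxx bv.
Qed.

Lemma coef_mul_top (p q : {poly F}) a b :
  (size p <= a.+1)%N -> (size q <= b.+1)%N -> (p * q)`_(a + b) = p`_a * q`_b.
Proof.
move=> sp sq; rewrite coefM.
have lta : (a < (a + b).+1)%N by rewrite ltnS leq_addr.
rewrite (bigD1 (Ordinal lta)) //= addKn big1 ?addr0 // => i neq.
have [lt|ge] := ltnP a i.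
  by rewrite nth_default ?mul0r // (leq_trans sp).
rewrite [q`_ _]nth_default ?mulr0 // (leq_trans sq) //.
have : i != a :> nat by apply: contra neq => /eqP e; apply/eqP/val_inj.
by have := ltn_ord i; lia.
Qed.

(** No cancellation of leading terms can occur in N u.  A linear relation
    between leading coefficients of columns, homogenized by powers of the
    indeterminate at the largest degree involved, would be a vector shorter than
    one of the columns occurring in it. *)
Lemma minimal_predictable m n k (P : 'M[{poly F}]_(m, n)) (N : 'M_(n, k))
    (u : 'cV_k) T :
  minimal_null_basis P N -> bounded (fun=> T) (N *m u) ->
  bounded (fun j => (T - col_degree N j)%N) u.
Proof.
move=> minN bNu; pose c := col_degree N.
have [/null_basisE[PN fN _] _] := minN.
pose D := (\max_(j | u j ord0 != 0%R) (size (u j ord0) + c j))%N.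
have leD j : u j 0 != 0 -> (size (u j 0%R) + c j <= D)%N.
  by move=> uj; apply: (@leq_bigmax_cond _ (fun j => u j ord0 != 0%R)).
suff leDT : (D <= T)%N.
  move=> j; have [->|/leD] := eqVneq (u j 0) 0; first by rewrite size_poly0.
  by move/leq_trans/(_ leDT)/(leq_sub2r (c j)); rewrite addnK.
rewrite leqNgt; apply/negP => ltTD.
case ED : D ltTD => [//|E] leTE.
(* al j is the coefficient with which the leading term of column j enters
   the coefficient of X^E in N u. *)
pose al j : F := if (c j <= E)%N then (u j 0)`_(E - c j) else 0.
have lead i : \sum_j al j * (N i j)`_(c j) = 0.
  have : ((N *m u) i 0)`_E = 0 by rewrite nth_default // (leq_trans (bNu i)).
  rewrite mxE coef_sum => E0; rewrite -[RHS]E0; apply: eq_bigr => j _; rewrite /al.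
  have [uj|uj] := eqVneq (u j 0) 0.
    by rewrite uj mulr0 !coef0 if_same mul0r.
  have := leD j uj; have : (0 < size (u j 0%R))%N by rewrite size_poly_gt0.
  rewrite ED => s0 sE.
  have cE : (c j <= E)%N by lia.
  rewrite cE -{2}(subnKC cE) coef_mul_top ?size_col_degree 1?mulrC //.
  by lia.
(* An index j attaining the maximum D contributes the leading coefficient of
   u_j. *)
have [j0 al0] : exists j, al j != 0.
  have [j uj Ej] : exists2 j, u j 0 != 0 & (size (u j 0%R) + c j = D)%N.
    have [j0 uj0] : exists j, u j ord0 != 0.
      apply/existsP; rewrite -negb_forall; apply/negP => /forallP u0.
      move: ED; rewrite /D big_pred0 // => j.
      by apply/negbTE; rewrite negbK; apply: u0.
    have := @eq_bigmax_cond _ (fun j => u j ord0 != 0%R)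
             (fun j => size (u j ord0) + c j)%N.
    case; first by apply/card_gt0P; exists j0.
    by move=> j uj Ej; exists j.
  exists j; rewrite /al.
  have s0 : (0 < size (u j 0%R))%N by rewrite size_poly_gt0.
  have -> : (c j <= E)%N by lia.
  have -> : (E - c j = (size (u j 0%R)).-1)%N by lia.
  by rewrite -lead_coefE lead_coef_eq0.
(* The entry of w at j1 is a nonzero constant, and N w has degree less than
   c_j1 because its coefficient there is the relation lead. *)
have [j1 al1 max1] := @arg_maxnP _ j0 (fun j => al j != 0) c al0.
pose w : 'cV[{poly F}]_k := \col_j (al j *: 'X^(c j1 - c j)).
have : (c j1 < c j1)%N.
  apply: (@minimal_exchange _ _ _ P N 1 (N *m w) w j1) => //.
  - by rewrite oner_neq0.
  - by rewrite scale1r.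
  - by rewrite mxE subnn expr0 scaler_eq0 (negPf al1) oner_eq0.
  move=> i; apply/leq_sizeP => l lel.
  have [ltl|eql] := ltnP (c j1) l.
    rewrite mxE coef_sum big1 // => j _; rewrite mxE.
    have [->|alj] := eqVneq (al j) 0; first by rewrite scale0r mulr0 coef0.
    rewrite -scalerAr coefZ nth_default ?mulr0 //.
    apply: (leq_trans (size_polyMleq _ _)); rewrite size_polyXn.
    have le1 : (c j <= c j1)%N := max1 _ alj.
    have : (size (N i j) <= (c j).+1)%N := size_col_degree N i j.
    by move: (size (N i j)) => s; lia.
  have -> : l = c j1 by apply/eqP; rewrite eqn_leq eql.
  rewrite mxE coef_sum -[RHS](lead i); apply: eq_bigr => j _; rewrite mxE.
  have [->|alj] := eqVneq (al j) 0; first by rewrite scale0r mulr0 coef0 mul0r.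
  rewrite -scalerAr coefZ coefMXn; have /= le1 := max1 _ alj.
  by rewrite ltnNge leq_subr /= subKn.
by rewrite ltnn.
Qed.

(** With q v = N w, dividing w by q leaves a polynomial vector v2 with
    q v2 = N w2 and w2 of smaller degree than q; if w2 were nonzero, v2 would be
    shorter than some column occurring in it, which the exchange property
    excludes. *)
Theorem minimal_generates m n k (P : 'M[{poly F}]_(m, n)) (N : 'M_(n, k))
    (v : 'cV_n) T :
  minimal_null_basis P N -> P *m v = 0 -> bounded (fun=> T) v ->
  exists2 u, bounded (fun j => (T - col_degree N j)%N) u & v = N *m u.
Proof.
move=> minN Pv bv; have [nbN _] := minN.
have [/= q q0 [w Ew]] := null_basis_coord nbN Pv.
suff [u Eu] : exists u, v = N *m u.
  by exists u => //; apply: (minimal_predictable minN); rewrite -Eu.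
pose w1 : 'cV_k := \col_j (w j 0 %/ q).
pose w2 : 'cV_k := \col_j (w j 0 %% q).
have Ew12 : w = q *: w1 + w2.
  by apply/colP => j; rewrite !mxE mulrC -divp_eq.
pose v2 := v - N *m w1.
have Ev2 : q *: v2 = N *m w2.
  by rewrite scalerBr Ew Ew12 mulmxDr -scalemxAr addrC addKr.
have [w20|w2n0] := eqVneq w2 0.
  exists w1; apply/eqP; rewrite -subr_eq0 -/v2; apply/eqP/colP => i.
  have /colP/(_ i)/eqP : q *: v2 = 0 by rewrite Ev2 w20 mulmx0.
  by rewrite !mxE mulf_eq0 (negPf q0) => /eqP.
have [j0 wj0] : exists j, w2 j 0 != 0.
  by case/cV0Pn: w2n0 => j; exists j.
have [j1 wj1 max1] := @arg_maxnP _ j0 (fun j => w2 j 0 != 0) (col_degree N) wj0.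
have : (col_degree N j1 < col_degree N j1)%N.
  apply: (minimal_exchange minN q0 Ev2 wj1) => i.
  have [->|vi0] := eqVneq (v2 i 0) 0; first by rewrite size_poly0.
  have : (size (q * v2 i 0)%R <= col_degree N j1 + (size q).-1)%N.
    have -> : q * v2 i 0 = (N *m w2) i 0 by rewrite -Ev2 [RHS]mxE.
    rewrite mxE; apply: (leq_trans (size_sum _ _ _)); apply/bigmax_leqP => j _.
    have [->|wj] := eqVneq (w2 j 0) 0; first by rewrite mulr0 size_poly0.
    apply: (leq_trans (size_polyMleq _ _)).
    have le1 : (col_degree N j <= col_degree N j1)%N := max1 _ wj.
    have : (size (w2 j 0%R) < size q)%N by rewrite mxE ltn_modp.
    have : (size (N i j) <= (col_degree N j).+1)%N := size_col_degree N i j.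
    by move: (size (N i j)) (size (w2 j 0)) => s s'; lia.
  rewrite size_mul //; have : (0 < size q)%N by rewrite size_poly_gt0.
  by move: (size q) (size (v2 i 0)) => a b; lia.
by rewrite ltnn.
Qed.

End MinimalBasis.

(** * Recognizing minimal bases, and realizing functionals by rows *)

Section MinimalityCriterion.
Variable F : fieldType.
Implicit Types m n k : nat.

(** Predictable degrees for prescribed weights g, which a column of N need
    not attain. *)
Definition generates m n k (P : 'M[{poly F}]_(m, n)) (N : 'M_(n, k))
    (g : 'I_k -> nat) :=
  forall T v, P *m v = 0 -> bounded (fun=> T) v ->
    exists2 u, bounded (fun j => (T - g j)%N) u & v = N *m u.

(** Applied column by column, the predictable degree property bounds the
    transition matrix. *)
Lemma generates_factor m n k l (P : 'M[{poly F}]_(m, n)) (N : 'M_(n, k)) g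
    (M : 'M_(n, l)) :
  generates P N g -> P *m M = 0 ->
  exists2 U, M = N *m U &
    forall j i, (size (U j i : {poly F}) <= (col_degree M i).+1 - g j)%N.
Proof.
move=> gN PM.
have colM i : exists2 u, bounded (fun j => ((col_degree M i).+1 - g j)%N) u &
                         col i M = N *m u.
  apply: gN => [|j]; last by rewrite mxE size_col_degree.
  by rewrite colE mulmxA PM mul0mx.
have /fin_all_exists2[u bu Eu] := colM.
exists (\matrix_(j, i) u i j 0) => [|j i]; last by rewrite mxE bu.
apply/matrixP => a i; have /colP/(_ a) := Eu i; rewrite !mxE => ->.
by apply: eq_bigr => j _; rewrite mxE.
Qed.

Lemma size_mul_bound (p q : {poly F}) a b :
  (size p <= a.+1)%N -> (size q <= b)%N -> (size (p * q)%R <= a + b)%N.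
Proof.
move=> sp sq; apply: (leq_trans (size_polyMleq _ _)).
by move: (size p) (size q) sp sq => s s'; lia.
Qed.

Lemma bounded_mul m n (U : 'M[{poly F}]_(m, n)) g c T v :
  (forall j i, (size (U j i) <= (c i).+1 - g j)%N) ->
  bounded (fun i => (T - c i)%N) v -> bounded (fun j => (T - g j)%N) (U *m v).
Proof.
move=> bU bv j; rewrite mxE; apply: (leq_trans (size_sum _ _ _)).
apply/bigmax_leqP => i _.
have [->|U0] := eqVneq (U j i) 0; first by rewrite mul0r size_poly0.
have [->|v0] := eqVneq (v i 0) 0; first by rewrite mulr0 size_poly0.
rewrite size_mul //; move: U0 v0; rewrite -!size_poly_gt0.
by move: (size (U j i)) (size (v i 0)) (bU j i) (bv i) => a b; lia.
Qed.

Lemma sum_sub k (a : 'I_k -> nat) T : (forall i, (a i <= T)%N) ->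
  (\sum_i (T - a i) + \sum_i a i = k * T)%N.
Proof.
move=> leT; rewrite -big_split /=.
under eq_bigr => i _ do rewrite subnK ?leT //.
by rewrite sum_nat_const card_ord.
Qed.

Lemma sum_le_of_truncated k (c g : 'I_k -> nat) :
  (forall T, \sum_j (T - c j) <= \sum_j (T - g j))%N ->
  (\sum_j g j <= \sum_j c j)%N.
Proof.
move=> le_cg; pose T := (\sum_j c j + \sum_j g j)%N.
have cT j : (c j <= T)%N by rewrite /T (bigD1 j) //= -!addnA leq_addr.
have gT j : (g j <= T)%N by rewrite /T addnC (bigD1 j) //= -!addnA leq_addr.
(* For T above all entries the truncated differences are exact. *)
by have := le_cg T; have := sum_sub cT; have := sum_sub gT; lia.
Qed.

Lemma injective_count m n (A : 'M[{poly F}]_(m, n)) (a : 'I_n -> nat) (b : 'I_m -> nat) :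
  col_free A -> (forall v, bounded a v -> bounded b (A *m v)) ->
  (\sum_i a i <= \sum_i b i)%N.
Proof.
move=> fA Ab.
have [] := @dimension_count F m n 0 A 0 a b (fun=> 0%N) Ab.
  by move=> v _ /fA->; exists 0; [case | rewrite mulmx0].
by rewrite big_ord0 addn0.
Qed.

(** Any other basis M is N U with weighted degrees under control, so for every
    T the map u |-> U u is injective between bounded spaces; for T large this
    compares the sums of the degrees. *)
Lemma minimal_intro m n k (P : 'M[{poly F}]_(m, n)) (N : 'M_(n, k)) g :
  null_basis P N -> generates P N g -> (forall j, (col_degree N j <= g j)%N) ->
  minimal_null_basis P N /\ forall j, col_degree N j = g j.
Proof.
move=> nbN gN leg.
have sum_g M : null_basis P M -> (\sum_j g j <= \sum_j col_degree (M : 'M_(n, k)) j)%N.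
  case/null_basisE=> PM fM _; have [U EM bU] := generates_factor gN PM.
  apply: sum_le_of_truncated => T; apply: (@injective_count _ _ U) => [v Uv|v].
    by apply: fM; rewrite EM -mulmxA Uv mulmx0.
  exact: bounded_mul.
have leN : (\sum_j col_degree N j <= \sum_j g j)%N by apply: leq_sum.
split=> [|j]; first by split=> // M /sum_g; apply: leq_trans.
apply/eqP; rewrite eqn_leq leg /= leqNgt; apply/negP => lt_j.
have := sum_g N nbN; rewrite leqNgt (bigD1 j) //= [X in (_ < X)%N](bigD1 j) //=.
by rewrite -addSn leq_add // leq_sum.
Qed.

(** The sum of the degrees is a natural number, so it attains its minimum. *)
Lemma exists_minimal_basis m n (P : 'M[{poly F}]_(m, n)) :
  exists k (N : 'M_(n, k)), minimal_null_basis P N.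
Proof.
have [k [N nbN]] := exists_null_basis P; exists k.
have [s les] : exists s, (\sum_j col_degree N j <= s)%N by exists (\sum_j col_degree N j)%N.
elim: s N nbN les => [|s IHs] N nbN les.
  by exists N; split=> // M _; apply: leq_trans les _.
have [[M [nbM ltM]]|noM] := classic (exists M : 'M_(n, k), null_basis P M /\
   (\sum_j col_degree M j < \sum_j col_degree N j)%N).
  by apply: (IHs M nbM); rewrite -ltnS; apply: leq_trans ltM _.
exists N; split=> // M nbM; rewrite leqNgt; apply/negP => ltM.
by apply: noM; exists M.
Qed.

(** The rows of P span the left null space of N: they are contained in it,
    and the ranks agree. *)
Lemma row_space_coord m n k (P : 'M[{poly F}]_(m, n)) (N : 'M_(n, k)) v :
  null_basis P N -> N^T *m v = 0 ->
  exists2 q, q != 0 & exists u : 'cV_m, q *: v = P^T *m u.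
Proof.
move=> /null_basisE[PN fN rkP] Nv.
have rkN : \rank (to_ratfun N)^T = k by apply/eqP; apply/col_freeP.
have : ((to_ratfun v)^T <= to_ratfun P)%MS.
  have sP : (to_ratfun P <= kermx (to_ratfun N))%MS.
    by apply/sub_kermxP; rewrite -to_ratfunM PN /to_ratfun map_mx0.
  have rkK : \rank (kermx (to_ratfun N)) = (n - k)%N.
    by rewrite mxrank_ker -mxrank_tr rkN.
  have /(submx_trans _): (kermx (to_ratfun N) <= to_ratfun P)%MS.
    rewrite -(mxrank_leqif_sup sP) rkK; apply/eqP; rewrite -/(normal_rank P).
    by move: rkP; lia.
  apply; apply/sub_kermxP; apply/trmx_inj/eqP.
  by rewrite trmx_mul trmxK trmx0 -to_ratfunT -to_ratfunM Nv /to_ratfun map_mx0.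
case/submxP => D ED; have [q q0 [U EU]] := clear_denominators D.
exists q => //; exists U^T; apply/trmx_inj/to_ratfun_inj.
rewrite trmx_mul !trmxK to_ratfunM -EU -scalemxAl -ED to_ratfunT.
by rewrite to_ratfunZ linearZ.
Qed.

(** Let E be a minimal basis of the left null space of N, which is the row
    space of P.  Every column of E occurs in some row of P, so its degree is at
    most d; and the indices of E add up to at least those of N, because E cuts
    out the null space spanned by N.  Thus w |-> w N on rows of degree at most d
    has a kernel small enough to be onto. *)
Lemma functional_realized m n k (P : 'M[{poly F}]_(m, n)) (N : 'M_(n, k)) d
    (b : 'rV[{poly F}]_k) :
  minimal_null_basis P N -> (mxdeg P <= d)%N ->
  (forall j, (size (b 0%R j) <= d.+1 + col_degree N j)%N) ->
  exists2 w : 'rV[{poly F}]_n, (mxdeg w <= d)%N & w *m N = b.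
Proof.
move=> minN degP bb; have [nbN _] := minN.
have [PN fN rkP] := (null_basisE _ _).1 nbN.
have [r [E minE]] := exists_minimal_basis N^T.
have [nbE _] := minE; have [NE fE rkE] := (null_basisE _ _).1 nbE.
have Er : (r + k)%N = n.
  rewrite -{}[RHS]rkE; congr addn; rewrite /normal_rank to_ratfunT.
  by apply/esym/eqP; apply/col_freeP.
have gE : generates N^T E (col_degree E).
  by move=> T v; apply: minimal_generates.
have NP : N^T *m P^T = 0 by rewrite -trmx_mul PN trmx0.
have [X EX bX] := generates_factor gE NP.
(* If column i of E were longer than d, row i of X would vanish, whereas a
   multiple of that column is a combination of the rows of P. *)
have eled i : (col_degree E i <= d)%N.
  rewrite leqNgt; apply/negP => lti.
  have Ni : N^T *m col i E = 0 by rewrite colE mulmxA NE mul0mx.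
  have [q q0 [u]] := row_space_coord nbN Ni.
  rewrite EX colE -mulmxA scalemxAr => /eqP.
  rewrite -subr_eq0 -mulmxBr => /eqP/fE.
  move/colP/(_ i); rewrite !mxE !eqxx mulr1 big1 ?subr0 => [q0'|j _].
    by rewrite q0' eqxx in q0.
  suff -> : X i j = 0 by rewrite mul0r.
  apply/eqP; rewrite -size_poly_leq0; apply: leq_trans (bX i j) _.
  rewrite leqn0 subn_eq0; apply: leq_trans lti; rewrite ltnS.
  by apply/col_degreeP => l; rewrite mxE; have /mxdegP/(_ j l) := degP.
(* Count vectors of degree less than T, for T large, against their products
   with E^T, whose null space has basis N. *)
have sumE : (\sum_j col_degree N j <= \sum_i col_degree E i)%N.
  pose T := (\sum_j col_degree N j)%N.
  have cT j : (col_degree N j <= T)%N by rewrite /T (bigD1 j) //= leq_addr.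
  have [] := @dimension_count F r n k E^T N (fun=> T)
               (fun i => (T + col_degree E i)%N) (fun j => (T - col_degree N j)%N).
  - move=> v bv i; rewrite mxE; apply: (leq_trans (size_sum _ _ _)).
    apply/bigmax_leqP => l _; rewrite mxE addnC.
    by apply: size_mul_bound => //; apply: size_col_degree.
  - move=> v bv Ev; apply: (minimal_generates minN) => //.
    by rewrite -[P]trmxK EX trmx_mul -mulmxA Ev mulmx0.
  rewrite big_split /= !sum_nat_const !card_ord => le_n _.
  have := sum_sub cT; have En : (n * T = r * T + k * T)%N by rewrite -Er mulnDl.
  move: le_n; rewrite En; move: (r * T)%N (k * T)%N => x y.
  by move=> + e; rewrite -e -addnA leq_add2l [leqRHS]addnC leq_add2l.
have [||_ surj] := @dimension_count F k n r N^T E (fun=> d.+1)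
    (fun j => (d.+1 + col_degree N j)%N) (fun i => (d.+1 - col_degree E i)%N).
- move=> v bv i; rewrite mxE; apply: (leq_trans (size_sum _ _ _)).
  apply/bigmax_leqP => l _; rewrite mxE addnC.
  by apply: size_mul_bound => //; apply: size_col_degree.
- by move=> v bv Ev; apply: gE.
have [||w bw Ew] := surj _ b^T; last 1 first.
- exists w^T; first by apply/mxdegP => i j; rewrite mxE (ord1 i).
  by apply: trmx_inj; rewrite trmx_mul trmxK.
- have eled' i : (col_degree E i <= d.+1)%N by rewrite leqW.
  have := sum_sub eled'; rewrite big_split /= !sum_nat_const !card_ord.
  have En : (n * d.+1 = r * d.+1 + k * d.+1)%N by rewrite -Er mulnDl.
  rewrite En => <-; rewrite [leqRHS]addnC -addnA leq_add2l [leqRHS]addnC.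
  by rewrite leq_add2r.
by move=> j; rewrite mxE.
Qed.

End MinimalityCriterion.

(** * Kernel of a chain functional *)

Section Chain.
Variable F : fieldType.
Implicit Types m n k : nat.

(** Weights come as a list, so that a weighted column can be prepended. *)
Definition wbounded k (c : seq nat) T (u : 'cV[{poly F}]_k) :=
  bounded (fun i : 'I_k => (T - nth 0%N c i)%N) u.

(** Q identifies the bounded vectors for the weights g with the kernel of b on
    the bounded vectors for the weights c, for all bounds T at once. *)
Definition weighted_kernel p q (c g : seq nat) (b : 'rV[{poly F}]_p)
    (Q : 'M[{poly F}]_(p, q)) :=
  [/\ b *m Q = 0, col_free Q,
      forall T y, wbounded g T y -> wbounded c T (Q *m y)
    & forall T u, wbounded c T u -> b *m u = 0 ->
        exists2 y, wbounded g T y & u = Q *m y].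

Lemma wbounded_col_mx k c0 c T (u0 : 'cV_1) (u : 'cV_k) :
  wbounded (c0 :: c) T (col_mx u0 u) <->
  (size (u0 0%R 0%R) <= T - c0)%N /\ wbounded c T u.
Proof.
split=> [bu | [bu0 bu] i].
  split=> [|i]; first by have := bu (lshift k 0); rewrite col_mxEu.
  by have := bu (rshift 1 i); rewrite col_mxEd.
by case: (split_ordP i) => j ->; rewrite ?col_mxEu ?col_mxEd ?(ord1 j) //; apply: bu.
Qed.

Lemma mulmx_cV1 k (y : 'cV[{poly F}]_1) (A : 'M_(k, 1)) : A *m y = y 0 0 *: A.
Proof. by rewrite [y]mx11_scalar mul_mx_scalar mxE. Qed.

(** Take b = (1, X^t0, X^(t0 + t1), ...) along s, with t_i = g_i - c_i, ending at
    v, and 0 on the remaining entries.  The relations X^(t_i) e_i - e_(i+1) form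
    a basis of the kernel, together with the unit vectors of the remaining
    entries; the i-th has weight g_i because c_(i+1) <= c_i <= g_i.  Prepending
    (c0, g0) multiplies the former b by X^t0, and the entry 1 at its head lets
    any value of b be corrected along e_1.  The bound on the entries of b is
    relative to v: on the remaining entries, which may be smaller than v, b is
    zero. *)
Lemma chain_kernel (s : seq (nat * nat)) v rest k :
  sorted geq (rcons (unzip1 s) v) -> all (fun p => p.1 <= p.2)%N s ->
  size (unzip2 s ++ rest) = k ->
  exists (b : 'rV[{poly F}]_(1 + k)) (Q : 'M_(1 + k, k)),
  [/\ b 0 (lshift k 0) = 1,
      forall i, (size (b 0%R i) <=
        (\sum_(p <- s) (p.2 - p.1)).+1 + nth 0 (unzip1 s ++ v :: rest) i - v)%N
    & weighted_kernel (unzip1 s ++ v :: rest) (unzip2 s ++ rest) b Q].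
Proof.
elim: s k => [|[c0 g0] s IHs] k /=.
  move=> _ _ sz; exists (row_mx 1%:M 0), (col_mx 0 1%:M).
  split=> [|i|].
  - by rewrite row_mxEl mxE.
  - rewrite big_nil; case: (split_ordP i) => j ->.
      by rewrite row_mxEl (ord1 j) mxE /= size_poly1 addnK.
    by rewrite row_mxEr mxE size_poly0.
  split.
  - by rewrite mul_row_col mulmx0 mul0mx addr0.
  - move=> u; rewrite mul_col_mx mul0mx mul1mx => /eqP.
    by rewrite col_mx_eq0 => /andP[_ /eqP].
  - move=> T y by_; rewrite mul_col_mx mul0mx mul1mx.
    by apply/wbounded_col_mx; split=> //; rewrite mxE size_poly0.
  move=> T u; rewrite -[u]vsubmxK => /wbounded_col_mx[_ bu].
  rewrite mul_row_col mul1mx mul0mx addr0 => u0; exists (dsubmx u) => //.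
  by rewrite mul_col_mx mul0mx mul1mx u0.
move=> srt /andP[le_cg le_s] szk.
case: k szk => [//|k] [sz]; rewrite -[k.+1]/(1 + k)%N.
have [b [Q [b00 bb [bQ fQ Qb kerb]]]] := IHs k (path_sorted srt) le_s sz.
have v_le_c0 : (v <= c0)%N.
  have gt : transitive geq by move=> ? ? ? h1 h2; apply: leq_trans h2 h1.
  have /allP := order_path_min gt srt.
  by apply; rewrite mem_rcons inE eqxx.
have hd_le : (nth 0 (unzip1 s ++ v :: rest) 0 <= c0)%N.
  by case: (s) srt => [|[a a'] s'] /= /andP[].
set t := (g0 - c0)%N.
have be1 : b *m (delta_mx (lshift k 0) 0 : 'cV__) = 1%:M.
  by rewrite -colE [LHS]mx11_scalar mxE b00.
exists (row_mx 1%:M ('X^t *: b)).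
exists (block_mx (- 'X^t)%:M 0 (delta_mx (lshift k 0) 0) Q); split.
- by rewrite row_mxEl mxE.
- move=> i; rewrite big_cons /= -/t; case: (split_ordP i) => j ->.
    by rewrite row_mxEl (ord1 j) mxE /= size_poly1; lia.
  rewrite row_mxEr mxE /=; have [->|bj] := eqVneq (b 0 j) 0.
    by rewrite mulr0 size_poly0.
  rewrite mulrC size_mulXn //; move: bj (bb j); rewrite -size_poly_gt0.
  by rewrite add0n; move: (size (b 0 j)) => a; lia.
split.
- rewrite mul_row_block !mul1mx -!scalemxAl be1 bQ scaler0 addr0.
  rewrite (_ : _ + _ = 0) ?row_mx0 //.
  by apply/matrixP => i j; rewrite !mxE !ord1 eqxx /= mulr1n mulr1 addNr.
- move=> u; rewrite -[u]vsubmxK mul_block_col mul0mx addr0 => /eqP.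
  rewrite col_mx_eq0 => /andP[/eqP u0 /eqP u1].
  have {}u0 : usubmx u = 0.
    apply/colP => i; move/colP/(_ i): u0; rewrite mul_scalar_mx !mxE => /eqP.
    by rewrite mulf_eq0 oppr_eq0 expf_eq0 polyX_eq0 andbF => /eqP.
  by move: u1; rewrite u0 mulmx0 add0r => /fQ->; rewrite col_mx0.
- move=> T y; rewrite -[y]vsubmxK => /wbounded_col_mx[by0 by1].
  rewrite mul_block_col mul0mx addr0; apply/wbounded_col_mx; split.
    rewrite mul_scalar_mx mxE mulNr size_polyN.
    move: by0; set p := usubmx _ 0 0; have [->|p0] := eqVneq p 0.
      by rewrite mulr0 size_poly0.
    rewrite mulrC size_mulXn // /t; move: p0; rewrite -size_poly_gt0.
    by move: (size p) => a; lia.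
  move=> i; rewrite mxE; apply: leq_trans (size_polyD _ _) _.
  rewrite geq_max; apply/andP; split; last exact: (Qb _ _ by1).
  rewrite mulmx_cV1; move: by0; set p := usubmx _ 0 0 => by0; rewrite mxE mxE.
  have [->|i0] := eqVneq i (lshift k 0); last by rewrite mulr0 size_poly0.
  by rewrite mulr1 (leq_trans by0) //; move: hd_le => /=; lia.
move=> T u; rewrite -[u]vsubmxK; move: (usubmx u) (dsubmx u) => {u} u0 u1.
move=> /wbounded_col_mx[bu0 bu1].
rewrite mul_row_col mul1mx -scalemxAl => E0.
move Ey0 : (b *m u1) E0 => y0 E0.
have {}E0 : u0 = - 'X^t *: y0 by rewrite scaleNr; apply/eqP; rewrite -addr_eq0 E0.
have by0 : (size (y0 0%R 0%R) <= T - g0)%N.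
  move: bu0; rewrite E0 mxE mulNr size_polyN; have [->|p0] := eqVneq (y0 0 0) 0.
    by rewrite size_poly0.
  rewrite mulrC size_mulXn // /t; move: p0; rewrite -size_poly_gt0.
  by move: (size (y0 0 0)) => a; lia.
(* Subtracting y0 e_1 brings the tail of u into the kernel of the former b;
   y0 = b u1 is small because u0 = - X^t y0 is bounded. *)
pose u2 := u1 - y0 0 0 *: delta_mx (lshift k 0) 0.
have bu2 : wbounded (unzip1 s ++ v :: rest) T u2.
  move=> i; rewrite !mxE; apply: leq_trans (size_polyD _ _) _.
  rewrite geq_max bu1 size_polyN /=.
  have [->|i0] := eqVneq i (lshift k 0); last by rewrite mulr0 size_poly0.
  by rewrite mulr1 (leq_trans by0) //; move: hd_le => /=; lia.
have bu20 : b *m u2 = 0.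
  rewrite mulmxBr -scalemxAr be1 Ey0 scalemx1.
  by rewrite -mx11_scalar subrr.
have [y1 by1 Ey1] := kerb _ _ bu2 bu20.
exists (col_mx y0 y1); first exact/wbounded_col_mx.
rewrite mul_block_col mul0mx addr0 mul_scalar_mx -E0 -Ey1 mulmx_cV1.
by congr col_mx; rewrite [RHS]addrC /u2 subrK.
Qed.

End Chain.

(** * Adding one row *)

Section Step.
Variable F : fieldType.
Implicit Types m n k : nat.

(** The minimal indices as a multiset: the bases constructed below have their
    columns in no particular order. *)
Definition indices m n (P : 'M[{poly F}]_(m, n)) (c : seq nat) :=
  exists k (N : 'M_(n, k)),
    minimal_null_basis P N /\ perm_eq (codom (col_degree N)) c.

Lemma geq_trans : transitive geq.
Proof. by move=> ? ? ? h1 h2; apply: leq_trans h2 h1. Qed.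

Lemma geq_total : total geq.
Proof. by move=> a b; apply: leq_total. Qed.

Lemma geq_anti : antisymmetric geq.
Proof. by move=> a b; rewrite andbC => /anti_leq. Qed.

Lemma column_minimal_indicesP m n (P : 'M[{poly F}]_(m, n)) c :
  column_minimal_indices P c <-> indices P c /\ sorted geq c.
Proof.
split=> [[k [N [minN ->]]]|[[k [N [minN pc]]] sc]].
  split; last exact: (sort_sorted geq_total).
  by exists k, N; split=> //; rewrite perm_sym perm_sort.
exists k, N; split=> //.
rewrite -(sorted_sort geq_trans sc); apply/esym.
exact/(perm_sortP geq_total geq_trans geq_anti).
Qed.

Lemma codom_nth k (f : 'I_k -> nat) (c : seq nat) :
  size c = k -> (forall j, f j = nth 0 c j)%N -> codom f = c.
Proof.
move=> sz Ef; rewrite codomE (eq_map Ef) (map_comp (nth 0%N c) val).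
by rewrite val_enum_ord map_nth_iota0 -sz // take_size.
Qed.

Lemma indices_ordered m n (P : 'M[{poly F}]_(m, n)) c k :
  indices P c -> size c = k ->
  exists2 N : 'M_(n, k), minimal_null_basis P N &
    forall j, col_degree N j = nth 0%N c j.
Proof.
move=> [k' [N [[nbN minN] pc]]] sz.
have Ek : k' = k by rewrite -sz -(perm_size pc) size_codom card_ord.
subst k'; move: pc; rewrite perm_sym.
have -> : codom (col_degree N) = [tuple col_degree N i | i < k] :> seq nat.
  by rewrite codomE.
case/tuple_permP => p Ec.
have degN' j : col_degree (col_perm p N) j = col_degree N (p j).
  by congr mxdeg; apply/matrixP => i l; rewrite !mxE.
exists (col_perm p N) => [|j]; last first.
  by rewrite degN' Ec -tnth_nth !tnth_mktuple.
have [PN fN rkP] := (null_basisE _ _).1 nbN.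
split.
  apply/null_basisE; split=> // [|u].
    by rewrite col_permE mulmxA PN mul0mx.
  rewrite col_permE -mulmxA => /fN /(congr1 (mulmx (perm_mx p))).
  by rewrite mulmxA -perm_mxM mulgV perm_mx1 mul1mx mulmx0.
move=> M nbM; under eq_bigr => j _ do rewrite degN'.
by rewrite -(reindex_inj (F := col_degree N) (P := xpredT) (@perm_inj _ p)); apply: minN.
Qed.

Lemma indices_perm m n (P : 'M[{poly F}]_(m, n)) c c' :
  perm_eq c c' -> indices P c -> indices P c'.
Proof.
move=> pcc' [k [N [minN pc]]]; exists k, N; split=> //.
exact: perm_trans pcc'.
Qed.

Lemma generates_null_basis m n k (P : 'M[{poly F}]_(m, n)) (N : 'M_(n, k)) g :
  P *m N = 0 -> col_free N -> generates P N g -> null_basis P N.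
Proof.
move=> PN fN gN; apply: null_basis_intro => // v Pv.
have [|u _ Ev] := gN (\max_i size (v i ord0))%N v Pv.
  by move=> i; apply: (leq_bigmax i).
by exists 1; rewrite ?oner_neq0 //; exists u; rewrite scale1r.
Qed.

(** A row of degree at most d can delete the index v and raise other indices,
    none of them below v, by a total of at most d + v.  The chain functional
    on the raised indices, sorted, followed by v, is realized by a row, and the
    image under N of its weighted kernel is the new minimal basis. *)
Lemma one_row_step m n (P : 'M[{poly F}]_(m, n)) d v (s : seq (nat * nat)) rest :
  indices P (v :: unzip1 s ++ rest) -> (mxdeg P <= d)%N ->
  all (fun p => v <= p.1 <= p.2)%N s ->
  (\sum_(p <- s) (p.2 - p.1) <= d + v)%N ->
  exists2 w : 'rV_n, (mxdeg w <= d)%N & indices (col_mx P w) (unzip2 s ++ rest).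
Proof.
move=> indP degP le_s le_sum.
pose r (p q : nat * nat) := geq p.1 q.1.
pose s' := sort r s.
have ps' : perm_eq s' s by rewrite perm_sort.
have s'srt : sorted geq (rcons (unzip1 s') v).
  rewrite sorted_pairwise; last exact: geq_trans.
  rewrite pairwise_rcons -sorted_pairwise; last exact: geq_trans.
  apply/andP; split.
    rewrite all_map; apply/allP => p; rewrite (perm_mem ps') => /(allP le_s).
    by case/andP.
  rewrite sorted_map; apply: (@sort_sorted _ r) => p q; exact: geq_total.
have le_s' : all (fun p => v <= p.1 <= p.2)%N s' by rewrite (perm_all _ ps').
have le_sum' : (\sum_(p <- s') (p.2 - p.1) <= d + v)%N by rewrite (perm_big _ ps').
have {}indP : indices P (unzip1 s' ++ v :: rest).
  apply: indices_perm indP; rewrite perm_sym -cat1s perm_catCA /= perm_cons.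
  by rewrite perm_cat2r perm_map.
suff [w dw iw] : exists2 w : 'rV_n, (mxdeg w <= d)%N
                   & indices (col_mx P w) (unzip2 s' ++ rest).
  exists w => //; apply: indices_perm iw.
  by rewrite perm_cat2r perm_map.
clear le_s le_sum; move: s' ps' s'srt le_s' le_sum' indP.
move=> {r} s0 _ {s}; move: s0 => s srt le_s le_sum indP.
pose k := size (unzip2 s ++ rest).
have szc : size (unzip1 s ++ v :: rest) = (1 + k)%N.
  by rewrite /k !size_cat !size_map /=; lia.
have [N minN degN] := indices_ordered indP szc.
have [||b [Q [_ bb [bQ fQ Qb kerb]]]] := @chain_kernel F s v rest k srt.
- by apply: sub_all le_s => p /andP[].
- by [].
have [//|j|w dw wN] := functional_realized (d := d) (b := b) minN.
  apply: leq_trans (bb j) _; rewrite degN.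
  move: le_sum; move: (\sum_(p <- s) _)%N (nth _ _ _) => S x; lia.
exists w => //.
have [nbN _] := minN; have [PN fN _] := (null_basisE _ _).1 nbN.
pose g (j : 'I_k) := nth 0%N (unzip2 s ++ rest) j.
have gN : generates (col_mx P w) (N *m Q) g.
  move=> T x /eqP; rewrite mul_col_mx col_mx_eq0 => /andP[/eqP Px /eqP wx] bx.
  have [u bu Ex] := minimal_generates minN Px bx.
  have bu' : wbounded (unzip1 s ++ v :: rest) T u by move=> j; rewrite -degN; apply: bu.
  have [|y by_ Eu] := kerb _ _ bu'; first by rewrite -wN -mulmxA -Ex.
  by exists y => //; rewrite -mulmxA -Eu.
have fNQ : col_free (N *m Q) by move=> u; rewrite -mulmxA => /fN /fQ.
have nbNQ : null_basis (col_mx P w) (N *m Q).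
  apply: generates_null_basis gN => //.
  by rewrite mul_col_mx !mulmxA PN wN bQ mul0mx col_mx0.
have [|minNQ degNQ] := minimal_intro nbNQ gN.
  move=> j; apply/col_degreeP => i.
  have by_ : wbounded (unzip2 s ++ rest) (g j).+1 (delta_mx j (0 : 'I_1) : 'cV[{poly F}]_k).
    move=> l; rewrite mxE; have [->|] := eqVneq l j; last by rewrite size_poly0.
    by rewrite eqxx size_poly1 -/(g j); lia.
  have bQy := Qb _ _ by_.
  have bNQ : bounded (fun=> ((g j).+1 - 0)%N) (N *m (Q *m delta_mx j (0 : 'I_1))).
    apply: (@bounded_mul _ _ _ N (fun=> 0%N) (col_degree N)) => [a l|l].
      by rewrite subn0 size_col_degree.
    by rewrite degN; apply: bQy.
  by have := bNQ i; rewrite mulmxA -colE mxE subn0.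
exists k, (N *m Q); split=> //.
by rewrite (@codom_nth _ _ (unzip2 s ++ rest)).
Qed.

End Step.

(** * Adding several rows *)

Section Fates.
Local Open Scope nat_scope.
Variable d : nat.
(** What becomes of an index: (c, Some e) is to be raised from c to e, and
    (c, None) is to be deleted. *)
Definition fate := (nat * option nat)%type.
Implicit Types (L : seq fate) (c ds : seq nat).

Definition deletion (t : fate) := ~~ isSome t.2.

Definition targets L := pmap snd L.

(** The list is read from the smallest index on.  Raises are paid from a credit
    b, to which each deletion of c adds d + c for the raises after it. *)
Fixpoint affordable b L : bool :=
  match L with
  | [::] => true
  | (c, Some e) :: L' => [&& c <= e, e - c <= b & affordable (b - (e - c)) L']
  | (c, None) :: L' => affordable (b + (d + c)) L'
  end.

(** A deleted index may only pay for indices that are not below it. *)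
Fixpoint deletions_low L : bool :=
  match L with
  | [::] => true
  | (c, Some _) :: L' => deletions_low L'
  | (c, None) :: L' => all (leq c) (unzip1 L') && deletions_low L'
  end.

(** Use the credit b at once, for the first raises of the list; a raise that b
    covers only partly remains as a smaller one. *)
Fixpoint spread b L : seq fate :=
  match L with
  | [::] => [::]
  | (c, Some e) :: L' =>
      (c + minn b (e - c), Some e) :: spread (b - minn b (e - c)) L'
  | (c, None) :: L' => (c, None) :: spread b L'
  end.

(** Spending b in advance loses nothing: what is left to pay is affordable
    without it. *)
Lemma affordable_spread b b' L : affordable (b + b') L -> affordable b' (spread b L).
Proof.
elim: L b b' => [//|[c [e|]] L IHL] b b' /=; last first.
  by rewrite -addnA => /IHL.
case/and3P=> ce le_bb' ok; apply/and3P; split; [lia|lia|].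
by apply: IHL; apply: etrans ok; congr affordable; lia.
Qed.

Lemma targets_spread b L : targets (spread b L) = targets L.
Proof.
rewrite /targets; elim: L b => [//|[c [e|]] L IHL] b /=; last exact: IHL.
by rewrite IHL.
Qed.

Lemma size_spread b L : size (spread b L) = size L.
Proof. by elim: L b => [//|[c [e|]] L IHL] b /=; rewrite IHL. Qed.

Definition raise L b := zip (unzip1 L) (unzip1 (spread b L)).

Lemma raise_le b L : all (fun p => p.1 <= p.2) (raise L b).
Proof.
elim: L b => [//|[c [e|]] L IHL] b; rewrite /raise /= ?leq_addr ?leqnn /=;
  exact: IHL.
Qed.

Lemma raise_sum b L : \sum_(p <- raise L b) (p.2 - p.1) <= b.
Proof.
elim: L b => [|[c [e|]] L IHL] b; rewrite /raise /= ?big_nil // big_cons /=.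
  by have := IHL (b - minn b (e - c)); rewrite /raise; lia.
by rewrite subnn add0n; apply: IHL.
Qed.

Lemma all_spread v b L : all (leq v) (unzip1 L) -> all (leq v) (unzip1 (spread b L)).
Proof.
elim: L b => [//|[c [e|]] L IHL] b /= /andP[vc /IHL vL]; rewrite vL andbT //.
by rewrite (leq_trans vc) ?leq_addr.
Qed.

Lemma deletions_low_spread b L : deletions_low L -> deletions_low (spread b L).
Proof.
elim: L b => [//|[c [e|]] L IHL] b /=; first exact: IHL.
by case/andP=> cL /IHL ->; rewrite all_spread.
Qed.

Lemma count_spread b L : count deletion (spread b L) = count deletion L.
Proof. by elim: L b => [//|[c [e|]] L IHL] b /=; rewrite IHL. Qed.

Definition keep (x : nat) : fate := (x, Some x).

(** Without credit, the indices before the first deletion have reached their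
    target. *)
Lemma first_deletion L : affordable 0 L ->
  (exists ks, L = map keep ks) \/
  (exists ks v L', L = map keep ks ++ (v, None) :: L').
Proof.
elim: L => [|[c [e|]] L IHL] /=; first by left; exists [::].
  case/and3P=> ce ec0; rewrite sub0n => /IHL{}IHL.
  have Ec : e = c by lia.
  rewrite {}Ec; case: IHL => [[ks ->]|[ks [v [L' ->]]]]; [left|right].
    by exists (c :: ks).
  by exists (c :: ks), v, L'.
by move=> _; right; exists [::], c, L.
Qed.

Lemma affordable_keep b ks L : affordable b (map keep ks ++ L) = affordable b L.
Proof. by elim: ks => [//|c ks IH] /=; rewrite leqnn subnn subn0 IH. Qed.

Lemma deletions_low_keep ks L : deletions_low (map keep ks ++ L) = deletions_low L.
Proof. by elim: ks. Qed.

Lemma unzip1_keep ks L : unzip1 (map keep ks ++ L) = ks ++ unzip1 L.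
Proof. by rewrite /unzip1 map_cat -map_comp map_id. Qed.

Lemma targets_keep ks L : targets (map keep ks ++ L) = ks ++ targets L.
Proof. by rewrite /targets; elim: ks => //= c ks ->. Qed.

Section Extend.
Variable F : fieldType.

Lemma eq_indices m m' n (P : 'M[{poly F}]_(m, n)) (P' : 'M_(m', n)) c :
  (forall v : 'cV_n, (P *m v = 0 <-> P' *m v = 0)%R) ->
  indices P c -> indices P' c.
Proof.
move=> PP' [k [N [[nbN minN] pc]]]; exists k, N; split; last exact: pc.
split; first exact: (eq_null_basis PP' nbN).
move=> M nbM; apply: minN; refine (eq_null_basis _ nbM) => v.
exact: iff_sym (PP' v).
Qed.

Lemma mxdeg_col_mx m1 m2 n (A : 'M[{poly F}]_(m1, n)) (B : 'M_(m2, n)) :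
  mxdeg A <= d -> mxdeg B <= d -> mxdeg (col_mx A B) <= d.
Proof.
move=> /mxdegP degA /mxdegP degB; apply/mxdegP => i j.
by case: (split_ordP i) => l ->; rewrite ?col_mxEu ?col_mxEd.
Qed.

(** By induction on the number of rows: the first deletion v takes one row,
    and its credit d + v is spread over the indices after it, which are at
    least v. *)
Lemma extension_of_fates m n (P : 'M[{poly F}]_(m, n)) L z :
  mxdeg P <= d -> indices P (unzip1 L) -> affordable 0 L -> deletions_low L ->
  count deletion L <= z ->
  exists2 W : 'M_(z, n), mxdeg W <= d & indices (col_mx P W) (targets L).
Proof.
elim: z m P L => [|z IHz] m P L degP indP ok low le_z.
all: have [[ks EL]|[ks [v [L' EL]]]] := first_deletion ok; subst L.
- exists 0%R; first by apply/mxdegP=> i j; rewrite mxE size_poly0.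
  move: indP; rewrite -[map _ _]cats0 unzip1_keep targets_keep !cats0; apply: eq_indices => u.
  rewrite mul_col_mx mul0mx; split=> [->|/eqP]; rewrite ?col_mx0 //.
  by rewrite col_mx_eq0 => /andP[/eqP].
- by move: le_z; rewrite count_cat /= addnCA.
- exists 0%R; first by apply/mxdegP=> i j; rewrite mxE size_poly0.
  move: indP; rewrite -[map _ _]cats0 unzip1_keep targets_keep !cats0; apply: eq_indices => u.
  rewrite mul_col_mx mul0mx; split=> [->|/eqP]; rewrite ?col_mx0 //.
  by rewrite col_mx_eq0 => /andP[/eqP].
move: ok low le_z indP; rewrite affordable_keep deletions_low_keep /= add0n.
rewrite count_cat /= => ok /andP[vL low] le_z indP.
have sz : size (unzip1 L') = size (unzip1 (spread (d + v) L')).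
  by rewrite !size_map size_spread.
have z1 : unzip1 (raise L' (d + v)) = unzip1 L' by rewrite unzip1_zip ?sz.
have z2 : unzip2 (raise L' (d + v)) = unzip1 (spread (d + v) L').
  by rewrite unzip2_zip ?sz.
have [|//||w dw iw] := @one_row_step _ _ _ P d v (raise L' (d + v)) ks _ degP.
- move: indP; apply: indices_perm; rewrite z1 unzip1_keep /=.
  by rewrite perm_catC.
- have := raise_le (d + v) L'; move: vL; rewrite -z1 all_map => vL le.
  apply/allP => p pr; apply/andP.
  by split; [exact: (allP vL) | exact: (allP le)].
- exact: raise_sum.
have [||||W dW iW] := IHz _ _ (map keep ks ++ spread (d + v) L') (mxdeg_col_mx degP dw).
- apply: indices_perm iw; rewrite z2 unzip1_keep.
  by rewrite perm_catC.
- by rewrite affordable_keep; apply: affordable_spread; rewrite addn0.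
- by rewrite deletions_low_keep; apply: deletions_low_spread.
- by rewrite count_cat count_spread; move: le_z; rewrite add1n addnS.
rewrite -[z.+1]/(1 + z); exists (col_mx w W); first exact: (mxdeg_col_mx dw dW).
move: iW; rewrite !targets_keep targets_spread; apply: eq_indices => u.
rewrite !mul_col_mx; split=> /eqP; rewrite !col_mx_eq0.
  by case/andP=> /andP[/eqP-> /eqP->] /eqP->; rewrite !col_mx0.
by case/andP=> /eqP-> /andP[/eqP-> /eqP->]; rewrite !col_mx0.
Qed.

End Extend.

(** Domination below every threshold, for the weights f; it is used with f = 1
    and with f x = x + d. *)
Definition dominates (f : nat -> nat) c ds :=
  forall T, \sum_(x <- ds | x < T) f x <= \sum_(x <- c | x < T) f x.

Lemma sum_lt_all (f : nat -> nat) (s : seq nat) T :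
  all (fun x => x < T) s -> \sum_(x <- s | x < T) f x = \sum_(x <- s) f x.
Proof.
by move=> /allP lt_s; rewrite big_seq_cond [RHS]big_seq; apply: eq_bigl => x;
  case xs: (x \in s) => //=; rewrite lt_s.
Qed.

Lemma sum_lt_le (f : nat -> nat) (s : seq nat) T :
  \sum_(x <- s | x < T) f x <= \sum_(x <- s) f x.
Proof. by rewrite [leqRHS](bigID (fun x => x < T)) /= leq_addr. Qed.

Lemma dominates_all f c ds : dominates f c ds -> \sum_(x <- ds) f x <= \sum_(x <- c) f x.
Proof.
pose T := (\sum_(x <- ds) x).+1.
move/(_ T); rewrite sum_lt_all => [/leq_trans|]; first by apply; apply: sum_lt_le.
by apply/allP => x xs; rewrite ltnS (big_rem x) //= leq_addr.
Qed.

Lemma geq_path_all e s : path geq e s -> all (fun x => x <= e) s.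
Proof. by move/(order_path_min geq_trans). Qed.

(** A threshold T above v lets all of c through, and the inequality between
    total sums suffices: v and e are removed on the two sides, and
    f v <= f e. *)
Lemma dominates_keep f v c e ds : {homo f : x y / x <= y} ->
  path geq v c -> path geq e ds -> v <= e ->
  dominates f (v :: c) (e :: ds) -> dominates f c ds.
Proof.
move=> fm /geq_path_all vc /geq_path_all eds ve D T.
have [Tv|vT] := leqP T v.
  by have := D T; rewrite !big_cons !ltnNge Tv (leq_trans Tv ve).
rewrite [leqRHS]sum_lt_all; last first.
  by apply: sub_all vc => x /leq_ltn_trans; apply.
apply: leq_trans (sum_lt_le _ _ _) _.
have := dominates_all D; rewrite !big_cons => le_sum.
by rewrite -(leq_add2l (f v)) (leq_trans _ le_sum) // leq_add2r fm.
Qed.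

(** All of e :: ds lies below v, so the inequality at threshold v, which does
    not see v, implies the inequality at the thresholds above v. *)
Lemma dominates_delete f v c e ds : path geq v c -> path geq e ds -> e < v ->
  dominates f (v :: c) (e :: ds) -> dominates f c (e :: ds).
Proof.
move=> /geq_path_all vc /geq_path_all eds ev D T.
have [Tv|vT] := leqP T v.
  by have := D T; rewrite [leqRHS]big_cons ltnNge Tv.
rewrite [leqRHS]sum_lt_all; last first.
  by apply: sub_all vc => x /leq_ltn_trans; apply.
apply: leq_trans (sum_lt_le _ _ _) _.
have := D v; rewrite sum_lt_all; last first.
  by rewrite /= ev; apply: sub_all eds => x /leq_ltn_trans; apply.
by rewrite [leqRHS]big_cons ltnn => /leq_trans; apply; apply: sum_lt_le.
Qed.

Lemma dominates_nil f c : dominates f c [::].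
Proof. by move=> T; rewrite big_nil. Qed.

(** Greedy matching of two nonincreasing lists: the largest index v is raised
    to the largest target e if e >= v, and can only be deleted otherwise. *)
Fixpoint assign_fates c ds : seq fate :=
  match c with
  | [::] => [::]
  | v :: c' =>
    match ds with
    | [::] => (v, None) :: assign_fates c' [::]
    | e :: ds' => if v <= e then (v, Some e) :: assign_fates c' ds'
                  else (v, None) :: assign_fates c' ds
    end
  end.

Lemma unzip1_assign_fates c ds : unzip1 (assign_fates c ds) = c.
Proof.
by elim: c ds => [//|v c IHc] [|e ds] /=; last case: ifP; rewrite /= IHc.
Qed.

Lemma targets_assign_fates c ds : sorted geq c -> sorted geq ds ->
  dominates (fun=> 1) c ds -> targets (assign_fates c ds) = ds.
Proof.
rewrite /targets; elim: c ds => [|v c IHc] ds sc sds D.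
  have := dominates_all D; rewrite big_nil sum1_size leqn0 => /nilP->.
  by case: ds {sds D}.
case: ds sds D => [|e ds] sds D /=.
  by rewrite IHc ?(path_sorted sc) //; apply: dominates_nil.
case: ifPn => [ve|]; rewrite /=.
  rewrite IHc ?(path_sorted sc) ?(path_sorted sds) //.
  exact: dominates_keep D.
rewrite -ltnNge => ev; rewrite IHc ?(path_sorted sc) //.
exact: dominates_delete D.
Qed.

Definition well_formed (t : fate) := if t.2 is Some e then t.1 <= e else true.

Lemma well_formed_assign_fates c ds : all well_formed (assign_fates c ds).
Proof.
elim: c ds => [//|v c IHc] [|e ds] /=; first exact: IHc.
by case: ifP => ve; rewrite /= IHc ?andbT.
Qed.

(** A raise from c to e costs (e + d) - (c + d) and a deletion of c yields
    c + d, so the credit accumulated over L is the difference of these sums. *)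
Definition balance_ok L :=
  \sum_(e <- targets L) (e + d) <= \sum_(x <- unzip1 L) (x + d).

(** Every suffix of the matching is the matching of a pair of lists that
    is again dominated, so its balance is the inequality between total sums. *)
Lemma balance_assign_fates c ds n : sorted geq c -> sorted geq ds ->
  dominates (fun=> 1) c ds -> dominates (addn^~ d) c ds ->
  balance_ok (drop n (assign_fates c ds)).
Proof.
elim: c ds n => [|v c IHc] ds n sc sds D1 Dd; first by rewrite /balance_ok /= !big_nil.
case: n => [|n].
  rewrite /balance_ok drop0 targets_assign_fates // unzip1_assign_fates.
  exact: dominates_all Dd.
case: ds sds D1 Dd => [|e ds] sds D1 Dd /=.
  by rewrite IHc ?(path_sorted sc) //; apply: dominates_nil.
case: ifPn => [ve|]; rewrite /=.
  apply: IHc; rewrite ?(path_sorted sc) ?(path_sorted sds) //.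
    exact: dominates_keep D1.
  by apply: dominates_keep Dd => // x y; rewrite leq_add2r.
rewrite -ltnNge => ev; apply: IHc; rewrite ?(path_sorted sc) //.
  exact: dominates_delete D1.
exact: dominates_delete Dd.
Qed.

Lemma affordable_prefix b L : all well_formed L ->
  (forall n, \sum_(e <- targets (take n L)) (e + d) <=
             b + \sum_(x <- unzip1 (take n L)) (x + d)) ->
  affordable b L.
Proof.
rewrite /targets; elim: L b => [//|[c [e|]] L IHL] b /=; last first.
  move=> wf le_n; apply: IHL => // n; have := le_n n.+1.
  by rewrite /= big_cons /=; lia.
rewrite {1}/well_formed /= => /andP[ce wf] le_n.
have le_eb : e - c <= b.
  by have := le_n 1; rewrite /= take0 /= !big_cons !big_nil /=; lia.
rewrite ce le_eb; apply: IHL => // n; have := le_n n.+1.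
by rewrite /= !big_cons /=; lia.
Qed.

Lemma targets_rev L : targets (rev L) = rev (targets L).
Proof.
rewrite /targets; elim: L => [//|[c [e|]] L IHL] /=.
all: by rewrite rev_cons -cats1 pmap_cat IHL /= ?cats1 ?cats0 ?rev_cons.
Qed.

Lemma affordable_assign_fates c ds : sorted geq c -> sorted geq ds ->
  dominates (fun=> 1) c ds -> dominates (addn^~ d) c ds -> affordable 0 (rev (assign_fates c ds)).
Proof.
move=> sc sds D1 Dd; apply: affordable_prefix => [|n].
  by rewrite all_rev well_formed_assign_fates.
rewrite take_rev targets_rev /unzip1 map_rev.
rewrite !(perm_big _ (permEl (perm_rev _))) /= add0n.
exact: (balance_assign_fates _ sc sds D1 Dd).
Qed.

Lemma deletions_low_rcons L t : all (geq t.1) (unzip1 L) ->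
  deletions_low L -> deletions_low (rcons L t).
Proof.
elim: L => [|[c [e|]] L IHL] /=; first by case: t => c [].
  by case/andP=> _; apply: IHL.
case/andP=> ct aL /andP[cL lowL]; rewrite IHL // andbT.
by rewrite /unzip1 map_rcons all_rcons ct.
Qed.

Lemma deletions_low_rev L : sorted geq (unzip1 L) -> deletions_low (rev L).
Proof.
elim: L => [//|t L IHL] /= sL; rewrite rev_cons deletions_low_rcons //.
  rewrite /unzip1 map_rev all_rev; exact: geq_path_all.
exact/IHL/(path_sorted sL).
Qed.

Lemma count_assign_fates c ds : sorted geq c -> sorted geq ds -> dominates (fun=> 1) c ds ->
  count deletion (assign_fates c ds) + size ds = size c.
Proof.
move=> sc sds D1.
have -> : size c = size (assign_fates c ds) by rewrite -{1}(unzip1_assign_fates c ds) size_map.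
have -> : size ds = size (targets (assign_fates c ds)) by rewrite targets_assign_fates.
rewrite /targets size_pmap addnC.
exact: count_predC.
Qed.

Theorem sufficiency (F : fieldType) m n (P : 'M[{poly F}]_(m, n)) c ds z :
  mxdeg P <= d -> indices P c -> sorted geq c -> sorted geq ds ->
  dominates (fun=> 1) c ds -> dominates (addn^~ d) c ds -> size c - size ds <= z ->
  exists2 W : 'M_(z, n), mxdeg W <= d & indices (col_mx P W) ds.
Proof.
move=> degP indP sc sds D1 Dd le_z.
have [||||W dW iW] := @extension_of_fates F m n P (rev (assign_fates c ds)) z degP.
- rewrite /unzip1 map_rev -/(unzip1 _) unzip1_assign_fates.
  by apply: indices_perm indP; rewrite perm_sym perm_rev.
- exact: affordable_assign_fates.
- by apply: deletions_low_rev; rewrite unzip1_assign_fates.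
- by rewrite count_rev; apply: leq_trans le_z; rewrite -(count_assign_fates sc sds D1) addnK.
exists W => //; apply: indices_perm iW; rewrite targets_rev targets_assign_fates //.
by rewrite perm_rev.
Qed.

End Fates.

(** * Necessity of the threshold inequalities *)

Definition selector (R : pzSemiRingType) k (A : pred 'I_k) : 'M[R]_k :=
  diag_mx (\row_i (A i)%:R).

Lemma rank_selector_le (K : fieldType) k (A : pred 'I_k) :
  (\rank (selector K A) <= #|A|)%N.
Proof.
rewrite /selector diag_mx_sum_delta (bigID A) /= [X in _ + X]big1 => [|i /negPf Ai].
  rewrite addr0 -sum1_card; elim/big_ind2: _ => [|B b C c leB leC|i Ai].
  - by rewrite mxrank0.
  - exact: leq_trans (mxrank_add _ _) (leq_add leB leC).
  - by rewrite mxE Ai scale1r mxrank_delta.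
by rewrite mxE Ai scale0r.
Qed.

Lemma rank_selector_ge (K : fieldType) k (A : pred 'I_k) :
  (#|A| <= \rank (selector K A))%N.
Proof.
have E : selector K A + selector K (predC A) = 1%:M.
  apply/matrixP => i j; rewrite !mxE /=; case: eqP => [->|_]; last by rewrite addr0.
  by rewrite !mulr1n; case: (A j); rewrite ?addr0 ?add0r.
have := mxrank_add (selector K A) (selector K (predC A)); rewrite E mxrank1.
have eC : (#|A| + #|predC A|)%N = k by rewrite -[RHS]card_ord -(cardC A).
have := rank_selector_le K (predC A); move: eC.
by move: (\rank _) (\rank _) #|_| #|_| => a b c e; lia.
Qed.

Section Necessity.
Variable F : fieldType.
Implicit Types m n k : nat.
Local Notation K := {fraction {poly F}}.

Lemma to_ratfun_selector k (A : pred 'I_k) :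
  to_ratfun (selector {poly F} A) = selector K A.
Proof. by apply/matrixP => i j; rewrite !mxE rmorphMn /= rmorph_nat. Qed.

Lemma mul_selector_sub k (A : pred 'I_k) l (v : 'M[{poly F}]_(k, l)) :
  (forall i j, ~~ A i -> v i j = 0) -> selector {poly F} A *m v = v.
Proof.
move=> v0; apply/matrixP => i j; rewrite mul_diag_mx !mxE.
by case Ai: (A i); rewrite ?mul1r // mul0r v0 ?Ai.
Qed.

(** Frobenius' rank inequality for B, the selection of I, and the columns of U
    selected by J, which B kills and which live on I. *)
Lemma rank_restriction m k l (B : 'M[{poly F}]_(m, k)) (U : 'M_(k, l))
    (I : pred 'I_k) (J : pred 'I_l) :
  col_free U -> B *m U = 0 -> (forall i j, J j -> ~~ I i -> U i j = 0) ->
  (normal_rank (B *m selector {poly F} I) + #|J| <= #|I|)%N.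
Proof.
move=> fU BU U0; pose D := selector K I; pose DJ := selector K J.
have := mxrank_Frobenius (to_ratfun B) D (to_ratfun U *m DJ).
have E : D *m (to_ratfun U *m DJ) = to_ratfun U *m DJ.
  rewrite /D /DJ -!to_ratfun_selector -!to_ratfunM; congr to_ratfun.
  apply: mul_selector_sub => i j Ii; rewrite mul_mx_diag !mxE.
  by case Jj : (J j); rewrite ?mulr0 // U0 ?mul0r.
rewrite -(mulmxA _ D) E (mulmxA (to_ratfun B)) -(to_ratfunM B U) BU.
rewrite [to_ratfun 0]map_mx0 mul0mx mxrank0 addn0.
have -> : \rank (to_ratfun U *m DJ) = \rank DJ.
  rewrite -mxrank_tr trmx_mul mxrankMfree ?mxrank_tr //; exact/col_freeP.
rewrite /normal_rank to_ratfunM to_ratfun_selector.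
have := rank_selector_le K I; have := rank_selector_ge K J; rewrite -/D -/DJ.
by move: (\rank _) (\rank _) (\rank _) => a b c; lia.
Qed.

(** A maximal independent set of rows defines the kernel. *)
Lemma max_rank_rows m n (A : 'M[{poly F}]_(m, n)) :
  exists f : 'I_(normal_rank A) -> 'I_m,
    forall v : 'cV_n, rowsub f A *m v = 0 -> A *m v = 0.
Proof.
exists (maxrankfun (to_ratfun A)) => v Av.
have /submxP[X EX] : (to_ratfun A <= rowsub (maxrankfun (to_ratfun A)) (to_ratfun A))%MS.
  by rewrite eq_maxrowsub.
apply: to_ratfun_inj; rewrite to_ratfunM EX -mulmxA /to_ratfun.
by rewrite -map_mxsub -map_mxM Av !map_mx0 mulmx0.
Qed.

Lemma sum_nth (f : nat -> nat) (c : seq nat) k (g : 'I_k -> nat) :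
  size c = k -> (forall i, g i = nth 0%N c i) ->
  (\sum_i f (g i) = \sum_(x <- c) f x)%N.
Proof.
move=> sz Eg; rewrite (big_nth 0%N) big_mkord sz.
by apply: eq_bigr => i _; rewrite Eg.
Qed.

Lemma sum_truncated (c : seq nat) T :
  (\sum_(x <- c) (T - x) + \sum_(x <- c | x < T) x =
   T * \sum_(x <- c | x < T) 1)%N.
Proof.
elim: c => [|x c IHc]; first by rewrite !big_nil muln0.
rewrite !big_cons; case: ltnP => xT; last by rewrite (eqP xT) add0n.
by rewrite mulnDr -IHc muln1; lia.
Qed.

Theorem necessity m n z d (P : 'M[{poly F}]_(m, n)) (W : 'M_(z, n)) c ds :
  indices P c -> (mxdeg W <= d)%N -> indices (col_mx P W) ds ->
  dominates (fun=> 1%N) c ds /\ dominates (addn^~ d) c ds.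
Proof.
move=> indP degW indPW.
have [N minN degN] := indices_ordered indP erefl.
have [M minM degM] := indices_ordered indPW erefl.
have [[nbN _] [nbM _]] := (minN, minM).
have [PN fN _] := (null_basisE _ _).1 nbN.
have [/eqP] := (null_basisE _ _).1 nbM.
rewrite mul_col_mx col_mx_eq0 => /andP[/eqP PM /eqP WM] fM _.
have gN : generates P N (col_degree N) by move=> T v; apply: minimal_generates.
have [U EM bU] := generates_factor gN PM.
have fU : col_free U by move=> v Uv; apply: fM; rewrite EM -mulmxA Uv mulmx0.
suff key T : let C := (\sum_(x <- c | x < T) 1)%N in
    let D := (\sum_(x <- ds | x < T) 1)%N in
    exists2 y, (y + D <= C)%N &
    (\sum_(x <- c) (T - x) <= y * (T + d) + \sum_(x <- ds) (T - x))%N.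
  split=> T; have [y /= leyT le_sum] := key T; first exact: leq_trans (leq_addl _ _) leyT.
  have Ed (s : seq nat) : (\sum_(x <- s | x < T) (x + d) =
       \sum_(x <- s | x < T) x + d * \sum_(x <- s | x < T) 1)%N.
    rewrite big_split big_distrr /=; congr addn.
    by apply: eq_bigr => x _; rewrite muln1.
  rewrite !Ed; have := sum_truncated c T; have := sum_truncated ds T.
  (* Multiply y + D <= C by T and by d. *)
  move: leyT le_sum.
  move: (\sum_(x <- c | x < T) 1)%N (\sum_(x <- ds | x < T) 1)%N => C D leyT le_sum.
  have h1 : (y * T + T * D <= T * C)%N by rewrite [(y * T)%N]mulnC -mulnDr leq_mul2l leyT orbT.
  have h2 : (y * d + d * D <= d * C)%N by rewrite [(y * d)%N]mulnC -mulnDr leq_mul2l leyT orbT.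
  by rewrite mulnDr in le_sum; lia.
move=> C D.
(* I and J select the columns of N and of M of degree less than T. *)
pose I : pred 'I_(size c) := fun i => (nth 0 c i < T)%N.
pose J : pred 'I_(size ds) := fun j => (nth 0 ds j < T)%N.
have cardE (s : seq nat) : #|[pred i : 'I_(size s) | (nth 0 s i < T)%N]| =
    (\sum_(x <- s | x < T) 1)%N.
  by rewrite -sum1_card (big_nth 0%N) big_mkord.
pose B := W *m N.
have BU : B *m U = 0 by rewrite -mulmxA -EM.
have U0 i j : J j -> ~~ I i -> U i j = 0.
  rewrite /I /J -leqNgt => Jj Ii; apply/eqP; rewrite -size_poly_leq0.
  apply: leq_trans (bU i j) _; rewrite degN degM leqn0 subn_eq0.
  exact: leq_trans Jj Ii.
pose BI := B *m selector {poly F} I.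
have rkBI := rank_restriction fU BU U0; rewrite -/BI in rkBI.
have [f rows_f] := max_rank_rows BI.
exists (normal_rank BI).
  have <- : #|I| = C := cardE c.
  by have <- : #|J| = D := cardE ds.
have Dv (v : 'cV[{poly F}]_(size c)) :
  bounded (fun i => (T - col_degree N i)%N) v -> selector {poly F} I *m v = v.
  move=> bv; apply: mul_selector_sub => i j; rewrite (ord1 j) -leqNgt => Ii.
  apply/eqP; rewrite -size_poly_leq0; apply: leq_trans (bv i) _.
  by rewrite leqn0 subn_eq0 degN.
have bNv (v : 'cV[{poly F}]_(size c)) :
  bounded (fun i => (T - col_degree N i)%N) v -> bounded (fun=> T) (N *m v).
  move=> bv i; rewrite -[T]subn0; move: i.
  apply: (@bounded_mul _ _ _ N (fun=> 0%N) (col_degree N)) => // a l.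
  by rewrite subn0 size_col_degree.
have [||le_dim _] := @dimension_count F _ _ _ (rowsub f BI) U
   (fun i => (T - col_degree N i)%N) (fun=> (T + d)%N) (fun j => (T - col_degree M j)%N).
- move=> v bv i; rewrite mul_rowsub_mx mxE -mulmxA Dv // -mulmxA.
  rewrite mxE; apply: (leq_trans (size_sum _ _ _)); apply/bigmax_leqP => l _.
  rewrite addnC; apply: size_mul_bound; last exact: bNv.
  by have /mxdegP/(_ (f i) l) := degW.
- move=> v bv /rows_f; rewrite -mulmxA Dv // => Bv.
  have PWv : col_mx P W *m (N *m v) = 0.
    by rewrite mul_col_mx mulmxA PN mul0mx mulmxA Bv col_mx0.
  have [u bu Eu] := minimal_generates minM PWv (bNv v bv).
  exists u => //; apply/eqP; rewrite -subr_eq0; apply/eqP/fN.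
  by rewrite mulmxBr Eu EM mulmxA subrr.
move: le_dim; rewrite sum_nat_const card_ord.
rewrite (@sum_nth (subn T) c) // (@sum_nth (subn T) ds) //.
Qed.

End Necessity.

(** * Threshold form of the generalized majorization *)

Section ThresholdForm.
Local Open Scope nat_scope.

Lemma ext_nth (s : seq nat) i : 0 < i <= size s ->
  ext (map Posz s) i = (Posz (nth 0 s i.-1))%:E.
Proof.
case: i => // i /= lti; rewrite /ext size_map lti /=.
by rewrite (nth_map 0).
Qed.

Lemma ext_oversize (s : seq nat) i : size s < i -> ext (map Posz s) i = -oo%E.
Proof. by case: i => // i lti; rewrite /ext size_map leqNgt lti. Qed.

(** The definition of h_j by a minimum over extended integers, in terms of
    entries indexed from 0. *)
Lemma maj_h_spec (c ds : seq nat) x j :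
  size c = size ds + x -> 0 < j <= x ->
  let h := maj_h (map Posz ds) (map Posz c) j in
  [/\ j <= h <= size ds + j,
      h - j < size ds -> nth 0 ds (h - j) < nth 0 c h.-1
    & forall i, j <= i < h -> nth 0 c i.-1 <= nth 0 ds (i - j)].
Proof.
move=> szc jx h.
have [lt_h min_h] : (ext (map Posz ds) (h.+1 - j) < ext (map Posz c) h)%E /\
  (forall i, (ext (map Posz ds) (i.+1 - j) < ext (map Posz c) i)%E -> h <= i).
  by apply: maj_hP jx; rewrite !size_map.
have /andP[j0 lejx] := jx.
have jh : j <= h.
  rewrite leqNgt; apply/negP => ltj; move: lt_h.
  have -> : h.+1 - j = 0 by lia.
  by rewrite {1}/ext /= ltNge leey.
have hle : h <= size ds + j.
  apply: min_h; rewrite ext_oversize; last by lia.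
  by rewrite ext_nth ?ltNyr //; lia.
have h0 : 0 < h <= size c by lia.
split=> [|lt|i /andP[ji ltih]]; first by rewrite jh.
  move: lt_h; rewrite subSn // !ext_nth ?lte_fin //=; lia.
rewrite leqNgt; apply/negP => lt_i.
suff /min_h : (ext (map Posz ds) (i.+1 - j) < ext (map Posz c) i)%E.
  by rewrite leqNgt ltih.
rewrite subSn // !ext_nth ?lte_fin //=; lia.
Qed.

Lemma sum_Posz (s : seq nat) : (\sum_(v <- map Posz s) v = (sumn s)%:Z)%R.
Proof. by elim: s => [|a s IHs]; rewrite ?big_nil //= big_cons IHs. Qed.

Lemma sum_take_a_hat c ds d x j : 0 < j <= x ->
  (\sum_(v <- take j (a_hat c ds d x)) v =
   (sumn c)%:Z - (sumn ds)%:Z + ((x - j) * d)%:Z)%R.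
Proof.
case: j x => [//|j] [//|x] lejx; rewrite /= big_cons take_nseq //.
rewrite big_nseq iter_addr_0 subSS mulNrn.
have -> : (d%:Z *+ j = (j * d)%:Z)%R.
  by elim: (j) => // i IH; rewrite mulrS IH mulSn PoszD.
have : j * d <= x * d by rewrite leq_mul2r (ltnSE (andP lejx).2) orbT.
by rewrite mulnBl; lia.
Qed.

Lemma sum_take_Posz h c : (\sum_(v <- take h (map Posz c)) v = (sumn (take h c))%:Z)%R.
Proof. by rewrite -map_take sum_Posz. Qed.

Lemma sumn_take_drop h s : sumn (take h s) + sumn (drop h s) = sumn s.
Proof. by rewrite -sumn_cat cat_take_drop. Qed.

Lemma sum_weight d s : \sum_(x <- s) (x + d) = sumn s + size s * d.
Proof. by elim: s => [|a s IHs]; rewrite ?big_nil //= big_cons IHs; lia. Qed.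

Lemma sum_lt_drop (f : nat -> nat) T q (s : seq nat) :
  all (leq T) (take q s) -> \sum_(x <- s | x < T) f x <= \sum_(x <- drop q s) f x.
Proof.
move=> ge_T; rewrite -[s in leqLHS](cat_take_drop q) big_cat /=.
rewrite big_seq_cond big1 => [|x /andP[xs]]; first exact: sum_lt_le.
by rewrite ltnNge (allP ge_T).
Qed.

Lemma sum_drop_lt (f : nat -> nat) T q (s : seq nat) :
  all (fun x => x < T) (drop q s) ->
  \sum_(x <- drop q s) f x <= \sum_(x <- s | x < T) f x.
Proof.
move=> lt_T; rewrite -[s in leqRHS](cat_take_drop q) big_cat /=.
by rewrite (sum_lt_all _ lt_T) leq_addl.
Qed.

Lemma sorted_nth_geq (s : seq nat) i j : sorted geq s -> i <= j -> j < size s ->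
  nth 0 s j <= nth 0 s i.
Proof.
move=> srt leij ltj.
have refl : reflexive geq by move=> a; apply: leqnn.
by apply: (sorted_leq_nth geq_trans refl 0 srt) => //; rewrite inE //; apply: leq_ltn_trans ltj.
Qed.

Lemma all_take_geq (s : seq nat) i T : sorted geq s ->
  (0 < i -> i.-1 < size s) -> (0 < i -> T <= nth 0 s i.-1) -> all (leq T) (take i s).
Proof.
move=> srt lti leT; apply/(all_nthP 0) => l; rewrite size_take_min leq_min => /andP[li ls].
rewrite nth_take //; have i0 : 0 < i by lia.
by apply: leq_trans (leT i0) _; apply: sorted_nth_geq; [|lia|exact: lti].
Qed.

Lemma all_drop_lt (s : seq nat) i T : sorted geq s ->
  (i < size s -> nth 0 s i < T) -> all (fun x => x < T) (drop i s).
Proof.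
move=> srt ltT; apply/(all_nthP 0) => l; rewrite size_drop nth_drop => ltl.
have lti : i < size s by lia.
by apply: leq_ltn_trans (ltT lti); apply: sorted_nth_geq; lia.
Qed.

Section Equivalence.
Variables (c ds : seq nat) (d x : nat).
Hypotheses (sc : sorted geq c) (sds : sorted geq ds) (szc : size c = size ds + x).
Let h j := maj_h (map Posz ds) (map Posz c) j.

Lemma size_a_hat : size (a_hat c ds d x) = x.
Proof. by rewrite /a_hat; case: (x) => //= x'; rewrite size_nseq. Qed.

(** As the two dropped parts differ in length by x - j, adding d to each entry
    absorbs the entries -d of a_hat. *)
Lemma maj_sum j : 0 < j <= x ->
  (\sum_(v <- take (h j) (map Posz c)) v - \sum_(v <- take (h j - j) (map Posz ds)) v
     <= \sum_(v <- take j (a_hat c ds d x)) v)%R <->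
  \sum_(v <- drop (h j - j) ds) (v + d) <= \sum_(v <- drop (h j) c) (v + d).
Proof.
move=> jx; have [/andP[jh hle] _ _] := maj_h_spec szc jx; rewrite -/(h j) in jh hle.
rewrite sum_take_a_hat // !sum_take_Posz !sum_weight !size_drop.
have := sumn_take_drop (h j) c; have := sumn_take_drop (h j - j) ds.
have -> : (size c - h j) * d = (size ds - (h j - j)) * d + (x - j) * d.
  by rewrite -mulnDl; congr muln; lia.
by move: ((size ds - _) * d) ((x - j) * d) => a b; split; lia.
Qed.

(** The inequality for j follows from the threshold c_(h_j): all d_i with
    i > h_j - j lie below it, and no c_i with i <= h_j does.  If
    d_i < c_(i + x), the threshold c_(i + x) violates the inequality between
    the numbers of entries. *)
Lemma gen_maj_of_dominates : dominates (fun=> 1) c ds -> dominates (addn^~ d) c ds ->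
  ((sumn ds)%:Z - (sumn c)%:Z <= (x * d)%:Z)%R /\
  gen_maj (map Posz c) (map Posz ds) (a_hat c ds d x).
Proof.
move=> D1 Dd.
have nth_le i : i < size ds -> nth 0 c (i + x) <= nth 0 ds i.
  move=> lti; rewrite leqNgt; apply/negP => lt_i.
  have := D1 (nth 0 c (i + x)); rewrite leqNgt => /negP; apply.
  apply: (@leq_ltn_trans (\sum_(v <- drop (i + x).+1 c) 1)).
    apply: sum_lt_drop; apply: all_take_geq => //=; lia.
  apply: (@leq_trans (\sum_(v <- drop i ds) 1)).
    by rewrite !sum1_size !size_drop szc; lia.
  by apply: sum_drop_lt; apply: all_drop_lt.
have le_sum : sumn ds + size ds * d <= sumn c + size c * d.
  by have := dominates_all Dd; rewrite !sum_weight.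
split; first by move: le_sum; rewrite szc mulnDl; lia.
split.
- by rewrite size_a_hat !size_map.
- move=> i; rewrite size_map size_a_hat => /andP[i0 le_i].
  rewrite !ext_nth ?lee_fin ?i0 ?addn_gt0 ?i0 ?szc //; try by lia.
  by case: i i0 le_i => // i _ lti; rewrite addSn /=; apply: nth_le.
- rewrite size_a_hat => j jx; apply/(maj_sum jx).
  have [/andP[jh hle] lt_h _] := maj_h_spec szc jx; rewrite -/(h j) in jh hle lt_h *.
  apply: leq_trans (leq_trans (Dd (nth 0 c (h j).-1)) _).
    by apply: sum_drop_lt; apply: all_drop_lt.
  by apply: sum_lt_drop; apply: all_take_geq => //; lia.
rewrite !sum_Posz; have [x0|x0] := posnP x; last first.
  have := @sum_take_a_hat c ds d x x; rewrite take_oversize ?size_a_hat // x0 leqnn.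
  by move=> /(_ isT) ->; rewrite subnn mul0n; lia.
rewrite x0 /= big_nil addr0; congr Posz; apply/eqP; rewrite eqn_leq.
apply/andP; split; last by move: le_sum; rewrite szc x0 addn0; lia.
rewrite !sumnE [leqLHS](big_nth 0) [leqRHS](big_nth 0) szc x0 addn0 !big_mkord.
apply: leq_sum => i _.
by have := nth_le i (ltn_ord i); rewrite x0 addn0.
Qed.

(** The numbers of entries are compared by the first majorization condition.
    For the sums, given T, let p be the number of c_i >= T and take the largest j with
    h_j <= p (and h_0 = 0, for which the inequality is condition (i)).  Then
    c_(i + j) <= d_i for all i <= p - j, by minimality of h_(j+1), or by the first
    majorization condition if j = x.  So the inequality at h_j can be
    moved up to p, and the d_i with i <= p - j are not below T. *)
Lemma dominates_of_gen_maj :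
  ((sumn ds)%:Z - (sumn c)%:Z <= (x * d)%:Z)%R ->
  gen_maj (map Posz c) (map Posz ds) (a_hat c ds d x) ->
  dominates (fun=> 1) c ds /\ dominates (addn^~ d) c ds.
Proof.
move=> le0 [_ le_ext le_maj _]; rewrite size_map size_a_hat in le_ext le_maj.
have nth_le i : i < size ds -> nth 0 c (i + x) <= nth 0 ds i.
  move=> lti; have := le_ext i.+1; rewrite !ext_nth ?lee_fin ?szc //; try by lia.
  by apply.
have split_c T : exists p, [/\ p <= size c, all (leq T) (take p c) &
                             all (fun v => v < T) (drop p c)].
  exists (find (fun v => v < T) c); split; first exact: find_size.
    apply/(all_nthP 0) => l; rewrite size_take_min leq_min => /andP[ltl _].
    by rewrite nth_take // leqNgt (before_find _ ltl).
  apply: all_drop_lt => // ltf; by apply: (@nth_find _ 0 (fun v => v < T) c); rewrite has_find.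
have ge_take T p q : q <= p <= size c -> all (leq T) (take p c) ->
    (forall i, i < q -> i < size ds /\ nth 0 c (i + (p - q)) <= nth 0 ds i) ->
    all (leq T) (take q ds).
  move=> qp geT le_i; apply/(all_nthP 0) => l; rewrite size_take_min leq_min => /andP[lq ls].
  rewrite nth_take //; have [_] := le_i l lq; apply: leq_trans.
  have := all_nthP 0 geT (l + (p - q)); rewrite size_take_min leq_min nth_take; last by lia.
  by apply; lia.
split=> T; have [p [pc geT ltT]] := split_c T.
  apply: leq_trans (sum_drop_lt _ ltT).
  apply: leq_trans (@sum_lt_drop _ _ (p - x) _ _) _.
    have [px|xp] := leqP p x.
      have -> : p - x = 0 by lia.
      by rewrite take0.
    apply: (ge_take T p) => // [|i ltip]; first by lia.
    by rewrite subKn ?(ltnW xp) //; split; [lia | apply: nth_le; lia].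
  by rewrite !sum1_size !size_drop; lia.
pose Q j := (j <= x) && ((j == 0) || (h j <= p)).
have exQ : exists j, Q j by exists 0.
have [j /andP[jx Qj] maxj] := @ex_maxnP Q x exQ (fun j Qj => proj1 (andP Qj)).
pose hj := if j == 0 then 0 else h j.
have hjp : j <= hj <= p.
  move: Qj; rewrite /hj; have [->//|j0] := eqVneq j 0.
  move=> /= ->; rewrite andbT.
  have jx' : 0 < j <= x by rewrite lt0n j0.
  by have [/andP[]] := maj_h_spec szc jx'.
have start : \sum_(v <- drop (hj - j) ds) (v + d) <= \sum_(v <- drop hj c) (v + d).
  rewrite /hj; have [j0|j0] := eqVneq j 0.
    by rewrite j0 !drop0 !sum_weight szc mulnDl; lia.
  have jx' : 0 < j <= x by rewrite lt0n j0.
  by apply/(maj_sum jx'); apply: le_maj.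
have cds l : l < p - j -> l < size ds /\ nth 0 c (l + j) <= nth 0 ds l.
  move=> ltl; have [Ej|neqj] := eqVneq j x.
    by rewrite Ej in ltl *; split; [lia | apply: nth_le; lia].
  have ltjx : 0 < j.+1 <= x by lia.
  have lt_h : p < h j.+1.
    rewrite ltnNge; apply/negP => le_h; have /maxj : Q j.+1 by rewrite /Q le_h orbT; lia.
    by rewrite ltnn.
  have [/andP[_ hle] _ min_h] := maj_h_spec szc ltjx; rewrite -/(h _) in hle min_h.
  split; first by lia.
  have := min_h (l + j).+1; rewrite subSS addnK /=; apply; lia.
have step n : hj + n <= p -> \sum_(v <- drop (hj - j + n) ds) (v + d) <=
                             \sum_(v <- drop (hj + n) c) (v + d).
  elim: n => [|n IHn] le_n; first by rewrite !addn0.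
  have := IHn; rewrite (drop_nth 0 (n := hj + n)); last by lia.
  have [|lt_ds le_cd] := cds (hj - j + n); first by lia.
  have le_n' : hj + n <= p by lia.
  rewrite (drop_nth 0 lt_ds) !big_cons !addnS => /(_ le_n').
  move: le_cd; have -> : hj - j + n + j = hj + n by lia.
  by lia.
apply: leq_trans (sum_drop_lt _ ltT).
apply: leq_trans (@sum_lt_drop _ _ (p - j) _ _) _.
  apply: (ge_take T p) => // [|i ltip]; first by lia.
  by rewrite subKn; [exact: cds | lia].
have := step (p - hj); have -> : hj + (p - hj) = p by lia.
have -> : hj - j + (p - hj) = p - j by lia.
exact.
Qed.

End Equivalence.

End ThresholdForm.

(** * The completion theorem *)

Lemma size_indices (F : fieldType) m n (P : 'M[{poly F}]_(m, n)) c :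
  indices P c -> (size c + normal_rank P = n)%N.
Proof.
move=> [k [N [[nbN _] pc]]]; have [_ _ rkP] := (null_basisE _ _).1 nbN.
by rewrite -(perm_size pc) size_codom card_ord.
Qed.

Theorem corollary3p16 (F : fieldType) (m n d r : nat)
    (P : 'M[{poly F}]_(m, n)) (c : seq nat) (z x : nat) (ds : seq nat)
    (P_neq0 : P != 0) (degP : mxdeg P = d) (rankP : normal_rank P = r)
    (cP : column_minimal_indices P c)
    (hx : (x <= minn z (n - r))%N)
    (size_ds : size ds = (n - r - x)%N) (sorted_ds : sorted geq ds) :
  (exists W : 'M[{poly F}]_(z, n),
     [/\ (mxdeg W <= d)%N,
         normal_rank (col_mx P W) = (r + x)%N
       & column_minimal_indices (col_mx P W) ds])
  <->
  ((sumn ds)%:Z - (sumn c)%:Z <= (x * d)%:Z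
   /\ gen_maj (map Posz c) (map Posz ds) (a_hat c ds d x)).
Proof.
have [indP sc] := (column_minimal_indicesP _ _).1 cP.
have szP := size_indices indP; rewrite rankP in szP.
have szc : size c = (size ds + x)%N by lia.
split=> [[W [degW _ /column_minimal_indicesP[indPW _]]]|[le0 maj]].
  have [D1 Dd] := necessity indP degW indPW.
  exact: gen_maj_of_dominates.
have [D1 Dd] := dominates_of_gen_maj sc sorted_ds szc le0 maj.
have [||W degW indPW] := @sufficiency d F m n P c ds z _ indP sc sorted_ds D1 Dd.
- by rewrite degP.
- by lia.
exists W; split=> //; last exact/column_minimal_indicesP.
by have := size_indices indPW; lia.
Qed.
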